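(* Let $X=G/K$ be a symmetric space of the noncompact type of rank $\ell>1$, with origin $o=eK$. For $f\in C_c^\infty(X)$ let $\hat f(\gamma)=\int_\gamma f(x)\,dm(x)$ denote its X-ray transform, where $\gamma$ is a complete geodesic in $X$ and $dm$ is arc-length measure on $\gamma$. For $p>0$ let $\Gamma_p$ be the set of geodesics and $\omega_p$ the measure on $\Gamma_p$ described in the context. Then the X-ray transform is inverted by the formula $$ f(o) = -\frac{1}{\pi}\int_0^\infty \left(\frac{d}{dp}\int_{\Gamma_p}\hat f(\gamma)\,d\omega_p(\gamma)\right)\frac{dp}{p},\qquad f\in C_c^\infty(X). $$
   Context: $G$ is a connected noncompact semisimple Lie group with finite center, $K\subset G$ is a maximal compact subgroup, and $X=G/K$ is the associated Riemannian symmetric space of the noncompact type (with $G$-invariant Riemannian metric), $o=eK$. The rank $\ell$ of $X$ is the maximal dimension of a flat totally geodesic submanifold of $X$. $d$ denotes the Riemannian distance. Fix a flat totally geodesic submanifold $E\subset X$ with $\dim E=\ell$ and $o\in E$; $E$ is isometric to Euclidean space $\mathbf R^\ell$. Let $\mathbf O(E)$ be the orthogonal group of $E$, i.e. the group of isometries of $E$ fixing $o$. The submanifolds $k\cdot E$, $k\in K$, are all the $\ell$-dimensional flat totally geodesic submanifolds of $X$ through $o$. For $p>0$ let $S=S_p(o)$ be the sphere in $E$ with center $o$ and radius $p$; the geodesics in $E$ tangent to $S$ are permuted transitively by $\mathbf O(E)$. $\Gamma_p$ is the set of all images $k\cdot\gamma$ with $k\in K$ and $\gamma$ a geodesic in $E$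 tangent to $S_p(o)$; equivalently, the set of all geodesics $\gamma$ in $X$ which lie in some flat $\ell$-dimensional totally geodesic submanifold of $X$ through $o$ and satisfy $d(o,\gamma)=p$. Fix any geodesic $\gamma\subset E$ tangent to $S_p(o)$. The measure $\omega_p$ on $\Gamma_p$ is the functional $$\omega_p(\varphi)=\int_{\Gamma_p}\varphi\,d\omega_p=\int_K\left(\int_{\mathbf O(E)}\varphi\bigl(k(u\cdot\gamma)\bigr)\,du\right)dk,$$ where $du$ and $dk$ are the Haar measures on $\mathbf O(E)$ and $K$ with total mass $1$. *)

(* Defs.v *)
From mathcomp Require Import all_boot all_order all_algebra.
From mathcomp Require Import all_classical all_reals all_analysis.
From mathcomp Require Import complex.

Set Implicit Arguments.
Unset Strict Implicit.
Unset Printing Implicit Defensive.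

Import Order.TTheory GRing.Theory Num.Theory numFieldNormedType.Exports.
Local Open Scope classical_set_scope.
Local Open Scope ring_scope.

(* R^n is 'rV[R]_n. The library norm on it is the sup norm (used only for the
   topology and for derivatives), so the Euclidean one is defined here. *)
Definition dot (R : realType) n (x y : 'rV[R]_n) : R := (x *m y^T) 0 0.
Definition enorm (R : realType) n (x : 'rV[R]_n) : R := Num.sqrt (dot x x).

(* For U open: all iterated partial derivatives of order <= k exist and are
   continuous on U. *)
Fixpoint class_C (R : realType) n (k : nat) (U : set 'rV[R]_n)
    (f : 'rV[R]_n -> R) : Prop :=
  (forall x, U x -> {for x, continuous f}) /\
  match k with
  | 0 => True
  | k'.+1 => forall i : 'I_n,
      (forall x, U x -> derivable f x (delta_mx 0 i)) /\
      class_C k' U (fun x => 'D_(delta_mx 0 i) f x)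
  end.

Definition smooth_scalar (R : realType) n (U : set 'rV[R]_n)
  (f : 'rV[R]_n -> R) := forall k, class_C k U f.

Definition smooth_vector (R : realType) n m (U : set 'rV[R]_n)
  (f : 'rV[R]_n -> 'rV[R]_m) := forall j, smooth_scalar U (fun x => f x 0 j).

(* v *m jacobian_mx f x is the derivative of f at x in the direction v. *)
Definition jacobian_mx (R : realType) n m (f : 'rV[R]_n -> 'rV[R]_m)
  (x : 'rV[R]_n) : 'M[R]_(n, m) :=
  \matrix_(i, j) 'D_(delta_mx 0 i) (fun y => f y 0 j) x.

Record chart (R : realType) (n : nat) (M : Type) := Chart {
  cdom : set M;
  cmap : M -> 'rV[R]_n;
  cinv : 'rV[R]_n -> M }.

Definition cimage (R : realType) n (M : Type) (a : chart R n M) :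
  set 'rV[R]_n := cmap a @` cdom a.

Definition is_chart (R : realType) n (M : topologicalType) (a : chart R n M) :=
  [/\ open (cdom a), open (cimage a),
      forall x, cdom a x -> cinv a (cmap a x) = x,
      forall x, cdom a x -> {for x, continuous (cmap a)} &
      forall y, cimage a y -> {for y, continuous (cinv a)}].

Definition compatible (R : realType) n (M : Type) (a b : chart R n M) :=
  smooth_vector (cmap a @` (cdom a `&` cdom b)) (cmap b \o cinv a).

Record manifold (R : realType) := Manifold {
  carrier :> ptopologicalType;
  dimM : nat;
  atlas : set (chart R dimM carrier);
  _ : hausdorff_space carrier;
  _ : @second_countable carrier;
  _ : forall a, atlas a -> is_chart a;
  _ : forall a b, atlas a -> atlas b -> compatible a b;
  atlas_cover : forall x, exists a, atlas a /\ cdom a x }.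

Definition prod_chart (R : realType) n m (M N : Type)
    (a : chart R n M) (b : chart R m N) : chart R (n + m) (M * N) :=
  Chart (cdom a `*` cdom b)
        (fun p => row_mx (cmap a p.1) (cmap b p.2))
        (fun v => (cinv a (lsubmx v), cinv b (rsubmx v))).

Definition prod_atlas (R : realType) n m (M N : Type)
    (A : set (chart R n M)) (B : set (chart R m N)) :
  set (chart R (n + m) (M * N)) :=
  [set c | exists a b, [/\ A a, B b & c = prod_chart a b]].

Definition euclidean_atlas (R : realType) n : set (chart R n 'rV[R]_n) :=
  [set Chart setT id id].

(* Smoothness on an open set D, between the atlases A and B. *)
Definition smooth_map (R : realType) n m (M N : topologicalType)
    (A : set (chart R n M)) (B : set (chart R m N)) (D : set M) (f : M -> N) :=
  (forall x, D x -> {for x, continuous f}) /\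
  forall a b, A a -> B b ->
    smooth_vector (cmap a @` (cdom a `&` D `&` f @^-1` cdom b))
                  (cmap b \o f \o cinv a).

Definition smooth_fun (R : realType) (M : manifold R) (f : M -> R) :=
  forall a, atlas a -> smooth_scalar (cimage a) (f \o cinv a).

Record lieGroup (R : realType) := LieGroup {
  lg_manifold :> manifold R;
  lmul : lg_manifold -> lg_manifold -> lg_manifold;
  lone : lg_manifold;
  linv : lg_manifold -> lg_manifold;
  _ : associative lmul;
  _ : left_id lone lmul;
  _ : left_inverse lone linv lmul;
  _ : smooth_map (prod_atlas (@atlas R lg_manifold) (@atlas R lg_manifold))
        (@atlas R lg_manifold) setT (fun p => lmul p.1 p.2);
  _ : smooth_map (@atlas R lg_manifold) (@atlas R lg_manifold) setT linv }.

Section LieAlgebra.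
Variables (R : realType) (G : lieGroup R).
Local Notation n := (dimM G).

(* In a chart a sending the identity to x0, the product reads
   (x0 + x) . (x0 + y) = x0 + x + y + B(x, y) + (terms of order >= 3) with B
   bilinear, and the Lie bracket on R^n = T_1 G is [v, w] = B(v, w) - B(w, v).
   B(v, w) is computed as a mixed second derivative. *)
Definition lie_bilin (a : chart R n G) (v w : 'rV[R]_n) : 'rV[R]_n :=
  'D_v (fun x => 'D_w (fun y => cmap a (lmul (cinv a x) (cinv a y)))
                      (cmap a (lone G))) (cmap a (lone G)).

Definition lie_bracket (a : chart R n G) (v w : 'rV[R]_n) : 'rV[R]_n :=
  lie_bilin a v w - lie_bilin a w v.

Definition killing_form (a : chart R n G) (v w : 'rV[R]_n) : R :=
  \tr (lin1_mx (lie_bracket a v) *m lin1_mx (lie_bracket a w)).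

Definition semisimple := forall a, atlas a -> cdom a (lone G) ->
  forall v, (forall w, killing_form a v w = 0) -> v = 0.

Definition lie_center : set G := [set z | forall h, lmul z h = lmul h z].

Definition is_subgroup (K : set G) :=
  [/\ K (lone G), forall h k, K h -> K k -> K (lmul h k) &
      forall k, K k -> K (linv k)].

Definition maximal_compact (K : set G) :=
  [/\ is_subgroup K, compact K &
      forall K', is_subgroup K' -> compact K' -> K `<=` K' -> K' = K].

End LieAlgebra.

Arguments lie_center {R} G.

(* A manifold with a smooth transitive action of G and a base point o whose
   isotropy group is K; for G second countable the orbit map g |-> g.o induces
   a G-equivariant diffeomorphism of G/K onto it. *)
Record homogeneousSpace (R : realType) (G : lieGroup R) (K : set G) :=
  HomogeneousSpace {
  hs_manifold :> manifold R;
  act : G -> hs_manifold -> hs_manifold;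
  origin : hs_manifold;
  _ : forall x, act (lone G) x = x;
  _ : forall g h x, act (lmul g h) x = act g (act h x);
  _ : smooth_map (prod_atlas (@atlas R G) (@atlas R hs_manifold))
        (@atlas R hs_manifold) setT (fun p => act p.1 p.2);
  _ : forall x y, exists g, act g x = y;
  _ : [set g | act g origin = origin] = K }.

(* A metric is given by its Gram matrices in the charts, as functions of the
   coordinates. metric_preserving A B gA gB D f says that f pulls the metric
   gB back to gA on D. *)
Definition metric_preserving (R : realType) n m (M N : Type)
    (A : set (chart R n M)) (B : set (chart R m N))
    (gA : chart R n M -> 'rV[R]_n -> 'M[R]_n)
    (gB : chart R m N -> 'rV[R]_m -> 'M[R]_m) (D : set M) (f : M -> N) :=
  forall a b, A a -> B b -> forall x, D x -> cdom a x -> cdom b (f x) ->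
    let J := jacobian_mx (cmap b \o f \o cinv a) (cmap a x) in
    gA a (cmap a x) = J *m gB b (cmap b (f x)) *m J^T.

Definition euclidean_metric (R : realType) n :
  chart R n 'rV[R]_n -> 'rV[R]_n -> 'M[R]_n := fun _ _ => 1%:M.

Record riemannianMetric (R : realType) (M : manifold R) := RiemannianMetric {
  gram :> chart R (dimM M) M -> 'rV[R]_(dimM M) -> 'M[R]_(dimM M);
  _ : forall a, atlas a -> forall i j,
        smooth_scalar (cimage a) (fun y => gram a y i j);
  _ : forall a, atlas a -> forall y, cimage a y ->
        (gram a y)^T = gram a y /\
        forall v, v != 0 -> 0 < dot (v *m gram a y) v;
  _ : metric_preserving (@atlas R M) (@atlas R M) gram gram setT id }.

Section RiemannianDistance.
Variables (R : realType) (M : manifold R) (g : riemannianMetric M).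

Definition chart_at (x : M) : chart R (dimM M) M := sval (cid (atlas_cover x)).

Definition C1_curve (c : R -> M) :=
  continuous c /\
  forall a t, atlas a -> cdom a (c t) ->
    derivable (cmap a \o c) t 1 /\ {for t, continuous (derive1 (cmap a \o c))}.

Definition speed (c : R -> M) (t : R) : R :=
  let a := chart_at (c t) in
  let v := derive1 (cmap a \o c) t in
  Num.sqrt (dot (v *m g a (cmap a (c t))) v).

Definition arc_length (c : R -> M) : R :=
  Rintegral (@lebesgue_measure R) `[0, 1]%classic (speed c).

(* x and y are joined by a piecewise C^1 curve of length L. *)
Inductive joined : M -> M -> R -> Prop :=
| joined_refl x : joined x x 0
| joined_step c y L : C1_curve c -> joined (c 1) y L ->
    joined (c 0) y (arc_length c + L).

Definition rdist (x y : M) : R := inf [set L | joined x y L].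

(* Unit-speed geodesics on an open set of parameters I: curves parametrised by
   arc length which locally realise the distance. *)
Definition geodesic_on (I : set R) (c : R -> M) :=
  forall t, I t -> exists2 e : R, 0 < e &
    forall s s', I s -> I s' -> `|s - t| < e -> `|s' - t| < e ->
      rdist (c s) (c s') = `|s - s'|.

Definition complete_geodesic (c : R -> M) := geodesic_on setT c.

(* An embedded k-dimensional submanifold with local parametrisations psi which
   are isometric for the flat metric of R^k (flatness) and whose straight
   segments, the geodesics of E, are geodesics of M (total geodesy). *)
Definition flat_totally_geodesic (k : nat) (E : set M) :=
  E !=set0 /\
  forall x, E x -> exists (V : set 'rV[R]_k) (psi : 'rV[R]_k -> M),
    [/\ open V, (psi @` V) x, {in V &, injective psi} &
        forall W, open W -> W `<=` V ->
          exists2 U : set M, open U & psi @` W = E `&` U] /\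
    [/\ smooth_map (@euclidean_atlas R k) (@atlas R M) V psi,
        metric_preserving (@euclidean_atlas R k) (@atlas R M)
          (@euclidean_metric R k) g V psi &
        forall y v, enorm v = 1 ->
          geodesic_on [set t : R | V (y + t *: v)]
            (fun t => psi (y + t *: v))].

Definition is_rank (l : nat) :=
  (exists E, flat_totally_geodesic l E) /\
  forall k E, flat_totally_geodesic k E -> (k <= l)%N.

(* An isometry of R^l onto E taking 0 to o, with its inverse. *)
Record flatIsometry (l : nat) (o : M) (E : set M) := FlatIsometry {
  toE : 'rV[R]_l -> M;
  ofE : M -> 'rV[R]_l;
  _ : cancel toE ofE;
  _ : range toE = E;
  _ : toE 0 = o;
  _ : smooth_map (@euclidean_atlas R l) (@atlas R M) setT toE;
  _ : metric_preserving (@euclidean_atlas R l) (@atlas R M)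
        (@euclidean_metric R l) g setT toE;
  _ : forall x y, rdist (toE x) (toE y) = enorm (x - y) }.

End RiemannianDistance.

Definition invariant_metric (R : realType) (G : lieGroup R) (K : set G)
    (X : homogeneousSpace K) (g : riemannianMetric X) :=
  forall h, metric_preserving (@atlas R X) (@atlas R X) g g setT (act h).

Definition borel (T : ptopologicalType) := g_sigma_algebraType (@open T).

(* The Haar measure of total mass 1 of the compact group H, as a Borel measure
   on the ambient space T carried by H. *)
Definition haar_probability (R : realType) (T : ptopologicalType)
    (op : T -> T -> T) (H : set T) (mu : probability (borel T) R) :=
  mu H = 1%E /\
  forall h, H h -> forall A : set (borel T), measurable A ->
    mu (op h @` A) = mu A.

(* Integrals, derivatives, and smoothness of complex valued functions are taken
   componentwise. *)
Definition cintegral (R : realType) d (T : measurableType d)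
    (mu : {measure set T -> \bar R}) (D : set T) (f : T -> R[i]) : R[i] :=
  Complex (Rintegral mu D (fun x => complex.Re (f x)))
          (Rintegral mu D (fun x => complex.Im (f x))).

Definition cintegrable (R : realType) d (T : measurableType d)
    (mu : {measure set T -> \bar R}) (D : set T) (f : T -> R[i]) :=
  mu.-integrable D (fun x => (complex.Re (f x))%:E) /\
  mu.-integrable D (fun x => (complex.Im (f x))%:E).

Definition cderivable (R : realType) (f : R -> R[i]) (p : R) :=
  derivable (fun q => complex.Re (f q)) p 1 /\
  derivable (fun q => complex.Im (f q)) p 1.

Definition cderive (R : realType) (f : R -> R[i]) (p : R) : R[i] :=
  Complex (derive1 (fun q => complex.Re (f q)) p)
          (derive1 (fun q => complex.Im (f q)) p).

Definition smooth_compact_support (R : realType) (M : manifold R)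
    (f : M -> R[i]) :=
  [/\ smooth_fun (fun x => complex.Re (f x)),
      smooth_fun (fun x => complex.Im (f x)) &
      compact (closure [set x | f x != 0])].

Definition orthogonal_group (R : realType) (l : nat) : set 'M[R]_l :=
  [set u | u *m u^T = 1%:M].

Definition xray (R : realType) (M : manifold R) (f : M -> R[i])
    (c : R -> M) : R[i] :=
  cintegral (@lebesgue_measure R) setT (fun t => f (c t)).

Section GammaP.
Variables (R : realType) (G : lieGroup R) (K : set G).
Variables (X : homogeneousSpace K) (g : riemannianMetric X).
Variables (l : nat) (E : set X) (e : flatIsometry g l (origin X) E).

(* On row vectors x |-> x *m u^T is the left action of O(l), so u |-> rotE u
   identifies O(l) with the group O(E) of isometries of E fixing o. *)
Definition rotE (u : 'M[R]_l) (x : X) : X := toE e (ofE e x *m u^T).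

(* Tangency to S_p(o): at a point of the sphere the velocity is orthogonal to
   the radius, in the Euclidean coordinates of E. *)
Definition tangent_geodesic (p : R) (c : R -> X) :=
  [/\ complete_geodesic g c, range c `<=` E &
      exists t, [/\ rdist g (origin X) (c t) = p,
        derivable (ofE e \o c) t 1 &
        dot (ofE e (c t)) (derive1 (ofE e \o c) t) = 0]].

Definition Gamma (p : R) : set (R -> X) :=
  [set c' | exists k c, [/\ K k, tangent_geodesic p c &
                            c' = (fun t => act k (c t))]].

(* c is the fixed geodesic of E tangent to S_p(o); phi, a function on Gamma_p,
   is extended by 0 outside Gamma_p. *)
Definition omega (muK : probability (borel G) R)
    (muO : probability (borel 'M[R]_l) R) (p : R) (c : R -> X)
    (phi : (R -> X) -> R[i]) : R[i] :=
  cintegral muK K (fun k : G =>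
    cintegral muO (@orthogonal_group R l) (fun u : 'M[R]_l =>
      let c' := (fun t => act k (rotE u (c t))) in
      if `[< Gamma p c' >] then phi c' else 0)).

End GammaP.

(* Main.v *)
Require Import Defs.
From mathcomp Require Import all_boot all_order all_algebra.
From mathcomp Require Import all_classical all_reals all_analysis.
From mathcomp Require Import complex.
From mathcomp Require Import measurable_realfun.
From mathcomp Require Import ring lra.

Set Implicit Arguments.
Unset Strict Implicit.
Unset Printing Implicit Defensive.

Import Order.TTheory GRing.Theory Num.Theory numFieldNormedType.Exports.
Local Open Scope classical_set_scope.
Local Open Scope ring_scope.

(** Averaging over K and O(l) reduces the formula to the inversion of an Abel
    transform in one variable.

    Let F(p) be the integral of the X-ray transform over Gamma_p. In the
    Euclidean coordinates of the flat E, a geodesic of E tangent to S_p(o) is a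
    straight line q + (t - t0) v with |q| = p, |v| = 1 and q orthogonal to v
    ([tangent_geodesic_line]), because a curve in R^l which locally preserves
    distances is affine ([isometric_curve_affine]); its point of parameter t is
    at distance sqrt(p^2 + (t - t0)^2) from o. For x in R^l, average
    f(k . toE(x u^T)) over u in O(l) and k in K. By invariance of the Haar
    measure of O(l), the average depends on |x| only
    ([integral_orthogonal_radial]); write it H(|x|). Then H is even with
    compact support, H(0) = f(o) since K fixes o, and Fubini's theorem gives

      F(p) = int_R H(sqrt(p^2 + t^2)) dt.

    Let h = H' and let L be a Lipschitz constant of h. As H is even, h(0) = 0
    and |h(r)| <= L |r|. Differentiating under the integral and substituting
    t = p s gives

      F'(p) / p = int_R h(p sqrt(1 + s^2)) / sqrt(1 + s^2) ds,

    and the bound on h makes the double integral over p > 0 and s converge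
    absolutely. The integral over p is - H(0) / (1 + s^2), hence the integral
    of F'(p) / p over p > 0 is - pi H(0) = - pi f(o) ([abel_inversion]).

    This requires h to be Lipschitz. In charts, (k, x) |-> f(k . toE x) has
    continuous second partial derivatives, so the second derivatives of
    r |-> f(k . toE(r v)) with |v| = 1 are bounded near each (k, x), and
    uniformly by compactness of K times a ball; outside a large ball everything
    vanishes, because the Riemannian distance is bounded near each point while
    toE preserves distances ([rdist_locally_bounded], [orbit_bounded],
    [radial_regularity]). These bounds pass to the average H.

    Measurability rests on second countability of G and of the matrix spaces,
    which makes a continuous function of several variables measurable for the
    product of their Borel sigma-algebras ([borel_fun_pair]). Real and
    imaginary parts of f are treated separately. *)

(** * Abel inversion *)

Section affine_substitution.
Context {R : realType}.
Local Notation mu := (@lebesgue_measure R).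
Implicit Types (a b : R).

Let measurable_affine a b : measurable_fun [set: measurableTypeR R]
    ((fun t : R => a * t + b) : measurableTypeR R -> measurableTypeR R).
Proof.
apply: continuous_measurable_fun => x.
by apply: cvgD; [apply: cvgMr; exact: cvg_id|exact: cvg_cst].
Qed.

Lemma lebesgue_measure_affine a b (A : set R) : 0 < a ->
  measurable A ->
  (mu ((fun t : R => (a * t + b)%R) @^-1` A) = a^-1%:E * mu A)%E.
Proof.
move=> a0 mA.
have mab := measurable_affine a b.
pose nu := mscale (NngNum (ltW a0)) (pushforward (@lebesgue_measure R)
  ((fun t : R => a * t + b) : measurableTypeR R -> measurableTypeR R)).
suff -> : lebesgue_measure A = nu mab A.
  by rewrite /nu /mscale /= muleA -EFinM mulVf ?gt_eqF// mul1e.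
apply: lebesgue_measure_unique => //= _ [[x y]] _ <-.
rewrite /nu /mscale /= /pushforward.
have -> : ((fun t : R => a * t + b) @^-1` `]x, y]) = `](x - b) / a, (y - b) / a]%classic.
  apply/seteqP; split=> t /=; rewrite !in_itv/= ltr_pdivrMr// ler_pdivlMr//;
  rewrite ltrBlDr lerBrDr [t * a]mulrC//.
rewrite !lebesgue_measure_itv/= !lte_fin ltr_pM2r ?invr_gt0// ltrD2r.
case: ifPn => _; last by rewrite mule0.
by rewrite -!EFinB -EFinM; congr (_%:E); field; rewrite gt_eqF.
Qed.

Lemma ge0_integral_affine a b (f : R -> \bar R) : 0 < a ->
  measurable_fun [set: R] f -> (forall x, 0 <= f x)%E ->
  (\int[mu]_t f (a * t + b)%R =
   a^-1%:E * \int[mu]_t f t)%E.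
Proof.
move=> a0 mf f0.
have ai0 : 0 <= a^-1 by rewrite invr_ge0 ltW.
have := @ge0_integral_pushforward _ _ _ _ R _ (measurable_affine a b) mu setT f measurableT mf.
move=> /(_ (fun x _ => f0 x)) /=.
rewrite preimage_setT => <-.
rewrite -(@ge0_integral_mscale _ _ _ mu setT measurableT (NngNum ai0) f mf)//.
apply: eq_measure_integral => A mA _.
by rewrite /= /pushforward /= lebesgue_measure_affine.
Qed.

Lemma Rintegral_affine a b (f : R -> R) : 0 < a ->
  mu.-integrable setT (EFin \o f) ->
  \int[mu]_t f (a * t + b) = a^-1 * \int[mu]_t f t.
Proof.
move=> a0 fi; rewrite /Rintegral.
have mf := measurable_int _ fi.
have -> : (\int[mu]_t (f (a * t + b)%R)%:E = a^-1%:E * \int[mu]_t (f t)%:E)%E.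
  rewrite [LHS]integralE [in RHS]integralE.
  rewrite muleBr//; last exact: integrable_add_def.
  rewrite -!(ge0_integral_affine b)//; last 2 first.
    exact: measurable_funeneg.
    exact: measurable_funepos.
  by congr (_ - _)%E; apply: eq_integral => t _; rewrite !(funeposE, funenegE).
rewrite fineM//.
exact: integrable_fin_num.
Qed.

End affine_substitution.

Section abel_inversion.
Context {R : realType}.
Variables (H h : R -> R) (L A : R).
Hypothesis A0 : 0 < A.
Hypothesis dH : forall r : R, is_derive r (1:R) H (h r).
Hypothesis liph : forall r s, `|h r - h s| <= L * `|r - s|.
Hypothesis evH : forall r, H (- r) = H r.
Hypothesis suppH : forall r, A < `|r| -> H r = 0.
Local Notation mu := (@lebesgue_measure R).

Let L0 : 0 <= L.
Proof. have := liph 1 0; rewrite subr0 normr1 mulr1; exact: le_trans. Qed.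

Let continuous_h : continuous h.
Proof.
move=> x; apply/cvgrPdist_le => e e0; near=> y.
rewrite (le_trans (liph _ _))//.
have : `|x - y| <= e / (L + 1).
  near: y; apply: cvgr_dist_le; first exact: cvg_id.
  by rewrite divr_gt0// ltr_wpDl.
rewrite ler_pdivlMr ?ltr_wpDl// => /(le_trans _); apply.
by rewrite mulrC ler_wpM2l// lerDl.
Unshelve. all: end_near. Qed.

(** The derivative of an even function is odd. *)
Let h0 : h 0 = 0.
Proof.
have e : H \o -%R = H by apply/funext => x /=; exact: evH.
have d1 : is_derive (0:R) (1:R) (H \o -%R) (h (- 0) * (-1)).
  apply: is_derive1_comp.
have := @derive_val _ _ _ _ _ _ _ d1; rewrite e => e1.
have := @derive_val _ _ _ _ _ _ _ (dH 0).
rewrite e1 oppr0 mulrN1 => ?; lra.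
Qed.

Let h_supp r : A < `|r| -> h r = 0.
Proof.
move=> Ar; rewrite -(@derive_val _ _ _ _ _ _ _ (dH r)).
rewrite (@near_eq_derive _ _ _ _ (cst 0)) ?derive_cst//.
near=> y.
apply: suppH; near: y.
by apply: (cvgr_gt `|r|) => //; apply: cvg_norm; exact: cvg_id.
Unshelve. all: end_near. Qed.

Let h_le r : `|h r| <= L * `|r|.
Proof. by have := liph r 0; rewrite h0 !subr0. Qed.

Let continuous_H : continuous H.
Proof.
move=> x; apply: differentiable_continuous; apply/derivable1_diffP.
exact: ex_derive.
Qed.

Lemma sqrtD_gt0 p t : 0 < p -> 0 < Num.sqrt (p ^+ 2 + t ^+ 2) :> R.
Proof. by move=> p0; rewrite sqrtr_gt0 ltr_pwDl ?sqr_ge0// exprn_gt0. Qed.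

Let is_derive_rho (p t : R) : 0 < p ->
   is_derive p (1:R) (fun p : R => Num.sqrt (p ^+ 2 + t ^+ 2)) (p / Num.sqrt (p ^+ 2 + t ^+ 2)).
Proof.
move=> p0.
have -> : p / Num.sqrt (p ^+ 2 + t ^+ 2) = (2 * Num.sqrt (p ^+ 2 + t ^+ 2))^-1 * (2 * p).
  by field; rewrite gt_eqF// sqrtD_gt0.
have -> : (fun p : R => Num.sqrt (p ^+ 2 + t ^+ 2)) = Num.sqrt \o (fun p : R => (p ^+ 2 + t ^+ 2)) by [].
apply: is_derive1_comp.
  by apply: is_derive1_sqrt; rewrite -sqrtr_gt0 sqrtD_gt0.
apply: is_derive_eq.
have -> : p%:A = p :> R by exact: mulr1.
by rewrite addr0; ring.
Qed.

(** The distance from the origin to a point at distance [t] from the foot of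
    the perpendicular on a line at distance [p]. *)
Let rho p t : R := Num.sqrt (p ^+ 2 + t ^+ 2).

Let continuous_rho p : continuous (rho p).
Proof.
move=> t; apply: (@cvg_comp _ _ _ (fun t => p ^+ 2 + t ^+ 2) Num.sqrt _ (nbhs (p ^+ 2 + t ^+ 2))).
  by apply: cvgD; [exact: cvg_cst|apply: (@exprn_continuous _ 2)].
exact: sqrt_continuous.
Qed.

Let le_rho p t : `|t| <= rho p t.
Proof. by rewrite -sqrtr_sqr ler_sqrt ?addr_ge0 ?sqr_ge0// lerDr sqr_ge0. Qed.

Let ge_rho p t : `|p| <= rho p t.
Proof. by rewrite -sqrtr_sqr ler_sqrt ?addr_ge0 ?sqr_ge0// lerDl sqr_ge0. Qed.

Let rho_ge0 p t : 0 <= rho p t. Proof. exact: sqrtr_ge0. Qed.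

Lemma integrable_bounded_support (f : R -> R) (M B : R) :
  measurable_fun [set: R] f -> (forall x, `|f x| <= M) ->
  (forall x, B < `|x| -> f x = 0) -> mu.-integrable setT (EFin \o f).
Proof.
move=> mf fM fB.
apply: (@le_integrable _ _ _ mu setT measurableT _ (fun x => (M * \1_(`[- B, B]%classic) x)%:E)).
- exact/measurable_EFinP.
- move=> x _ /=; rewrite lee_fin indicE.
  have M0 : 0 <= M by exact: le_trans (fM x).
  have [xB|xB] := leP `|x| B; last first.
    by rewrite fB// normr0.
  rewrite mem_set ?mulr1; last by rewrite /= in_itv/= -ler_norml.
  by rewrite (le_trans (fM x))// ler_norm.
- under eq_fun do rewrite EFinM.
  apply: integrableZl => //.
  exact: integrable_indic_itv.
Qed.

Let continuous_Hrho p : continuous (fun t => H (rho p t)).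
Proof. by move=> t; apply: continuous_comp; [exact: continuous_rho|exact: continuous_H]. Qed.

Let H_bounded : exists M, forall x, `|H x| <= M.
Proof.
have [M MH] : exists M, forall x, x \in `[- A, A] -> `|H x| <= M.
  have : compact (H @` `[- A, A]).
    apply: continuous_compact; last exact: segment_compact.
    exact: continuous_subspaceT.
  move=> /compact_bounded[M [_ HM]]; exists (M + 1) => x xA.
  by apply: HM; [rewrite ltrDl|exists x].
exists `|M| => x; have [xA|xA] := leP `|x| A; last by rewrite suppH// normr0.
apply: le_trans (ler_norm M); apply: MH.
by rewrite in_itv/= -ler_norml.
Qed.

Let integrable_Hrho p : mu.-integrable setT (EFin \o (fun t => H (rho p t))).
Proof.
have [M HM] := H_bounded.
apply: (@integrable_bounded_support _ M A) => //.
- exact: continuous_measurable_fun.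
- by move=> x xA; rewrite suppH// ger0_norm// (lt_le_trans xA).
Qed.

Let F p := \int[mu]_t H (rho p t).

Let is_derive_Hrho (p t : R) : 0 < p ->
  is_derive p (1:R) (fun p => H (rho p t)) (h (rho p t) * (p / rho p t)).
Proof. by move=> p0; apply: is_derive1_comp; exact: is_derive_rho. Qed.

(** The derivative of the integrand is dominated by [L * A] on the interval from
    [- A] to [A], because [p <= rho p t] and [h] vanishes where [rho p t > A]. *)
Let dF (p : R) : 0 < p -> is_derive p (1:R) F (\int[mu]_t (h (rho p t) * (p / rho p t))).
Proof.
move=> p0.
pose f p t := H (rho p t).
pose G t : R := (L * A) * \1_(`[- A, A]%classic) t.
have pin : `]0, p + 1[%classic p by rewrite /= in_itv/= p0/= ltrDl.
have fi : forall x : R, `]0, p + 1[%classic x -> mu.-integrable setT (EFin \o f x).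
  by move=> x _; exact: integrable_Hrho.
have df : forall (x y : R), `]0, p + 1[%classic x -> setT y -> derivable (f^~ y) x 1.
  move=> x y; rewrite /= in_itv/= => /andP[x0 _] _.
  exact: (@ex_derive _ _ _ _ _ _ _ (is_derive_Hrho _ x0)).
have G0 : forall y, 0 <= G y.
  by move=> y; rewrite mulr_ge0// mulr_ge0// ltW.
have Gi : mu.-integrable setT (EFin \o G).
  rewrite /comp; under eq_fun do rewrite EFinM.
  apply: integrableZl => //; exact: integrable_indic_itv.
have pE : forall (x y : R), `]0, p + 1[%classic x -> partial1of2 f x y = h (rho x y) * (x / rho x y).
  move=> x y; rewrite /= in_itv/= => /andP[x0 _].
  by rewrite /partial1of2 derive1E (@derive_val _ _ _ _ _ _ _ (is_derive_Hrho _ x0)).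
have Gle : forall (x y : R), `]0, p + 1[%classic x -> setT y -> `|partial1of2 f x y| <= G y.
  move=> x y xp _; rewrite pE//.
  have x0 : 0 < x by move: xp; rewrite /= in_itv/= => /andP[].
  have [yA|yA] := ltP A (rho x y).
    by rewrite h_supp ?mul0r ?normr0// ger0_norm.
  have r0 : 0 < rho x y by rewrite sqrtD_gt0.
  rewrite /G indicE mem_set ?mulr1; last first.
    by rewrite /= in_itv/= -ler_norml (le_trans (le_rho x y)).
  rewrite normrM -[leRHS]mulr1 ler_pM//.
    by rewrite (le_trans (h_le _))// ler_wpM2l// ger0_norm.
  rewrite ger0_norm ?divr_ge0 ?(ltW x0)// ler_pdivrMr// mul1r.
  by rewrite (le_trans _ (ge_rho _ _))// ler_norm.
have d1 := @derivable_under_integral _ _ _ mu f setT measurableT p 0 (p + 1) pin fi df G G0 Gi Gle.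
have := @differentiation_under_integral _ _ _ mu f setT measurableT p 0 (p + 1) pin fi df G G0 Gi Gle.
under eq_Rintegral do rewrite pE//.
rewrite derive1E => <-.
exact/derivableP.
Qed.

(** The value of [rho p t / p] when [t = p * s]. *)
Let sigma s : R := Num.sqrt (1 + s ^+ 2).

Let sigma_ge1 s : 1 <= sigma s.
Proof. by rewrite -[leLHS]sqrtr1 ler_sqrt ?addr_ge0 ?sqr_ge0// lerDl sqr_ge0. Qed.

Let rhoZ p s : 0 < p -> rho p (p * s) = p * sigma s.
Proof.
move=> p0; rewrite /rho /sigma exprMn -{1}[p ^+ 2]mulr1 -mulrDr sqrtrM ?sqr_ge0//.
by rewrite sqrtr_sqr gtr0_norm.
Qed.

(** The substitution t = p s, by which [rho p t] becomes [p * sigma s]. *)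
Let dFN (p : R) : 0 < p ->
  derive1 F p / p = \int[mu]_s (h (p * sigma s) / sigma s).
Proof.
move=> p0; rewrite derive1E (@derive_val _ _ _ _ _ _ _ (dF p0)).
rewrite mulrC -(@Rintegral_affine _ p 0 (fun t => h (rho p t) * (p / rho p t)))//; last first.
  apply: (@integrable_bounded_support _ (L * A) A).
  - apply: continuous_measurable_fun => t; apply: cvgM.
      by apply: continuous_comp; [exact: continuous_rho|exact: continuous_h].
    apply: cvgM; first exact: cvg_cst.
    by apply: cvgV; [rewrite gt_eqF// sqrtD_gt0|exact: continuous_rho].
  - move=> t.
    have [yA|yA] := ltP A (rho p t).
      by rewrite h_supp ?mul0r ?normr0// ?ger0_norm// mulr_ge0// ltW.
    have r0 : 0 < rho p t by rewrite sqrtD_gt0.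
    rewrite normrM -[leRHS]mulr1 ler_pM//.
      by rewrite (le_trans (h_le _))// ler_wpM2l// ger0_norm.
    rewrite ger0_norm ?divr_ge0 ?(ltW p0)// ler_pdivrMr// mul1r.
    by rewrite (le_trans _ (ge_rho _ _))// ler_norm.
  - move=> t tA; rewrite h_supp ?mul0r//.
    by rewrite ger0_norm// (lt_le_trans tA).
apply: eq_Rintegral => s _; rewrite addr0 rhoZ//; congr (_ * _).
have := sigma_ge1 s => ?; field.
by rewrite !gt_eqF//; lra.
Qed.

(** The integrand of [dFN], extended by zero to [p <= 0], so that Fubini's
    theorem can be applied on the whole plane. *)
Let N (z : R * R) : R := \1_(`]0%R, +oo[%classic) z.1 * (h (z.1 * sigma z.2) / sigma z.2).

Let continuous_sigma : continuous sigma.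
Proof.
move=> t; apply: (@cvg_comp _ _ _ (fun t => 1 + t ^+ 2) Num.sqrt _ (nbhs (1 + t ^+ 2 : R))).
  by apply: cvgD; [exact: cvg_cst|apply: (@exprn_continuous _ 2)].
exact: sqrt_continuous.
Qed.

Let measurable_N : measurable_fun [set: R * R] N.
Proof.
have ms : measurable_fun [set: R * R] (sigma \o snd).
  apply: measurableT_comp => //; exact: continuous_measurable_fun.
apply: measurable_funM.
  apply: measurableT_comp => //.
apply: measurable_funM.
  apply: (measurableT_comp (continuous_measurable_fun continuous_h)).
  exact: measurable_funM.
have -> : (fun x : R * R => (sigma x.2)^-1) = (fun s => (sigma s)^-1) \o snd by [].
apply: measurableT_comp => //.
apply: continuous_measurable_fun => s; apply: cvgV; last exact: continuous_sigma.
have := sigma_ge1 s => ?; rewrite gt_eqF//; lra.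
Qed.

(** For fixed [s] the integrand is supported in an interval of length
    [A / sigma s]; with the bound [|h r| <= L |r|] its integral over [p] is at
    most [L A^2 / (1 + s^2)], which is integrable in [s]. *)
Let N_le p s : `|N (p, s)| <= L * A / sigma s * \1_(`[0, A / sigma s]%classic) p.
Proof.
have s1 := sigma_ge1 s; have s0 : 0 < sigma s by lra.
have r0 : 0 <= L * A / sigma s by rewrite !mulr_ge0 ?invr_ge0// ltW.
rewrite /N /= !indicE.
have [p0|p0] := ltP 0 p; last first.
  rewrite memNset; last by rewrite /= in_itv/= andbT ltNge p0.
  by rewrite mul0r normr0 mulr_ge0.
rewrite mem_set ?mul1r; last by rewrite /= in_itv/= p0.
have [pA|pA] := ltP A (p * sigma s).
  have -> : h (p * sigma s) = 0 by apply: h_supp; rewrite ger0_norm// mulr_ge0// ltW.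
  by rewrite mul0r normr0; apply: mulr_ge0.
rewrite mem_set ?mulr1; last by rewrite /= in_itv/= (ltW p0)/= ler_pdivlMr.
rewrite normrM [X in _ * X]ger0_norm ?invr_ge0 ?(ltW s0)//.
rewrite ler_wpM2r ?invr_ge0 ?(ltW s0)//.
by rewrite (le_trans (h_le _))// ler_wpM2l// ger0_norm// mulr_ge0// ltW.
Qed.

Let int_oneDsqrV : (\int[mu]_x ((1 + x ^+ 2)^-1)%:E = (pi : R)%:E)%E.
Proof.
rewrite ge0_symfun_integralT; last 3 first.
- by move=> x; rewrite invr_ge0 addr_ge0 ?sqr_ge0.
- exact: continuous_oneDsqrV.
- by move=> x /=; rewrite sqrrN.
- have -> : [set x : R | 0 <= x] = `[0, +oo[%classic by rewrite set_itvcy.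
  by rewrite integral0y_oneDsqr -EFinM; congr EFin; field.
Qed.

Let integrable_N : (mu \x mu)%E.-integrable setT (EFin \o N).
Proof.
apply/integrable21ltyP; first exact/measurable_EFinP.
apply: (@le_lt_trans _ _ (\int[mu]_s ((L * A ^+ 2)%:E * ((1 + s ^+ 2)^-1)%:E))%E).
  apply: ge0_le_integral => //.
  - by move=> x _; apply: integral_ge0.
  - apply: (@measurable_fun_fubini_tonelli_G _ _ _ _ _ mu (abse \o (EFin \o N))).
      by apply: measurableT_comp => //; exact/measurable_EFinP.
    by move=> x; exact: abse_ge0.
  - apply/measurable_EFinP; apply: measurable_funM => //.
    apply: continuous_measurable_fun; exact: continuous_oneDsqrV.
  move=> s _.
  have s1 := sigma_ge1 s; have s0 : 0 < sigma s by lra.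
  have r0 : 0 <= L * A / sigma s by rewrite !mulr_ge0 ?invr_ge0// ltW.
  apply: (@le_trans _ _ (\int[mu]_p ((L * A / sigma s)%:E * (\1_(`[0, A / sigma s]%classic) p)%:E))%E).
    apply: ge0_le_integral => //.
    + apply: measurableT_comp => //; apply/measurable_EFinP.
      exact: (measurableT_comp measurable_N).
    + by apply/measurable_EFinP; apply: measurable_funM.
    + by move=> x _; rewrite -EFinM lee_fin N_le.
  rewrite ge0_integralZl//; last exact/measurable_EFinP.
  rewrite integral_indic// setIT.
  rewrite [X in (_ * X <= _)%E](_ : _ = (A / sigma s)%:E); last first.
    transitivity (@lebesgue_measure R `[0, A / sigma s]%classic) => //.
    by rewrite lebesgue_measure_itv/= lte_fin divr_gt0// -EFinB subr0.
  rewrite -!EFinM lee_fin.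
  have -> : (1 + s ^+ 2) = sigma s ^+ 2 by rewrite sqr_sqrtr// addr_ge0// sqr_ge0.
  by rewrite le_eqVlt; apply/orP; left; apply/eqP; field; rewrite gt_eqF.
rewrite ge0_integralZl//.
- by rewrite int_oneDsqrV -EFinM ltry.
- by apply/measurable_EFinP; apply: continuous_measurable_fun; exact: continuous_oneDsqrV.
- by move=> x _; rewrite lee_fin invr_ge0 addr_ge0 ?sqr_ge0.
- by rewrite lee_fin mulr_ge0 ?sqr_ge0.
Qed.

(** An antiderivative in [p] of the integrand is
    [H (p * sigma s) / sigma s ^+ 2]; it vanishes at [A + 1] as
    [sigma s >= 1]. *)
Let inner s : (\int[mu]_p (N (p, s))%:E = (- H 0 * (1 + s ^+ 2)^-1)%:E)%E.
Proof.
have s1 := sigma_ge1 s; have s0 : 0 < sigma s by lra.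
pose g p := h (p * sigma s) / sigma s.
transitivity (\int[mu]_(p in `[0%R, (A + 1)%R]) (g p)%:E)%E.
  rewrite [RHS]integral_mkcond; apply: eq_integral => p _.
  rewrite /patch /N indicE /=.
  have [p0|p0] := ltP 0 p.
    rewrite mem_set ?mul1r; last by rewrite /= in_itv/= p0.
    case: ifPn => //; rewrite notin_setE/= in_itv/= (ltW p0)/= => /negP; rewrite -ltNge => pA.
    by rewrite h_supp ?mul0r// ger0_norm ?mulr_ge0 ?(ltW s0) ?(ltW p0)//; nra.
  rewrite memNset ?mul0r; last by rewrite /= in_itv/= andbT; apply/negP; rewrite -leNgt.
  case: ifPn => //; rewrite inE/= in_itv/= => /andP[p1 _].
  have -> : p = 0 by lra.
  by rewrite /g mul0r h0 mul0r.
pose P p := H (p * sigma s) / sigma s ^+ 2.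
have dP (p : R) : is_derive p (1:R) P (g p).
  have -> : g p = (h (p * sigma s) * sigma s) * (sigma s ^+ 2)^-1.
    by rewrite /g; field; rewrite gt_eqF.
  have -> : P = (H \o (fun p => p * sigma s)) * cst ((sigma s ^+ 2)^-1) by [].
  have ? : is_derive p (1:R) (H \o (fun p => p * sigma s)) (h (p * sigma s) * sigma s).
    apply: is_derive1_comp; apply: is_derive_eq.
    by rewrite scaler0 add0r scaler1.
  apply: is_derive_eq.
  by rewrite scaler0 add0r /GRing.scale/= mulrC.
have cP : continuous P.
  move=> x; apply: differentiable_continuous; apply/derivable1_diffP; exact: ex_derive.
rewrite (@continuous_FTC2 _ g P); last 4 first.
- by rewrite addr_gt0.
- apply: continuous_subspaceT => x; apply: cvgM; last exact: cvg_cst.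
  apply: continuous_comp; last exact: continuous_h.
  by apply: cvgM; [exact: cvg_id|exact: cvg_cst].
- split.
  + by move=> x _; exact: ex_derive.
  + by apply: cvg_at_right_filter; exact: cP.
  + by apply: cvg_at_left_filter; exact: cP.
- by move=> x _; rewrite derive1E derive_val.
- rewrite /P mul0r -EFinB; congr EFin.
  have -> : H ((A + 1) * sigma s) = 0.
    have A1 : 0 <= (A + 1) * (sigma s - 1) by rewrite mulr_ge0 ?subr_ge0// addr_ge0// ltW.
    apply: suppH; rewrite ger0_norm; last by rewrite mulr_ge0 ?addr_ge0// ltW.
    by move: A1; rewrite mulrBr mulr1 subr_ge0; apply: lt_le_trans; rewrite ltrDl.
  rewrite mul0r sub0r mulNr; congr (- (_ / _)).
  by rewrite sqr_sqrtr// addr_ge0// sqr_ge0.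
Qed.

Let fin_N p : (\int[mu]_s (N (p, s))%:E)%E \is a fin_num.
Proof.
apply: integrable_fin_num => //.
have [p0|p0] := ltP 0 p; last first.
  rewrite (_ : (fun _ => _) = cst 0%E); first exact: integrable0.
  apply/funext => s; rewrite /N indicE memNset ?mul0r//= in_itv/= andbT.
  by apply/negP; rewrite -leNgt.
apply: (@integrable_bounded_support _ (L * A) (A / p)).
- exact: (measurableT_comp measurable_N).
- move=> s; apply: (le_trans (N_le _ _)).
  have s1 := sigma_ge1 s; have s0 : 0 < sigma s by lra.
  rewrite -[leRHS]mulr1 ler_pM//.
  + by rewrite !mulr_ge0 ?invr_ge0// ltW.
  + by rewrite ler_pdivrMr// ler_peMr// mulr_ge0// ltW.
- move=> s sA; rewrite /N /= h_supp ?mul0r ?mulr0//.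
  rewrite ger0_norm ?mulr_ge0 ?(le_trans ler01 (sigma_ge1 _)) ?ltW//.
  rewrite mulrC -ltr_pdivrMr//; apply: (lt_le_trans sA).
  by rewrite -sqrtr_sqr ler_sqrt ?addr_ge0 ?sqr_ge0// lerDr.
Qed.

Let dFNE p : 0 < p -> ((derive1 F p / p)%:E = \int[mu]_s (N (p, s))%:E)%E.
Proof.
move=> p0; rewrite dFN// /Rintegral.
rewrite -(fineK (fin_N p)); congr (fine _)%:E; apply: eq_integral => s _.
by rewrite /N indicE mem_set ?mul1r//= in_itv/= p0.
Qed.

Theorem abel_inversion :
  [/\ forall p, 0 < p -> derivable F p 1,
   mu.-integrable `]0, +oo[%classic (fun p => (derive1 F p / p)%:E) &
   \int[mu]_(p in `]0, +oo[%classic) (derive1 F p / p) = - pi * H 0].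
Proof.
have NE (p : R) : ((fun p => \int[mu]_s (N (p, s))%:E) p = ((fun p => (derive1 F p / p)%:E) \_ `]0%R, +oo[%classic) p)%E.
  rewrite patchE; case: ifPn => [|]; first by rewrite inE/= in_itv/= andbT => p0; rewrite dFNE.
  move=> pn; rewrite -[RHS](@integral0 _ _ _ mu setT); apply: eq_integral => s _.
  by rewrite /N indicE (negbTE pn) mul0r.
split.
- by move=> p p0; exact: (@ex_derive _ _ _ _ _ _ _ (dF p0)).
- apply/integrable_mkcond => //.
  apply: eq_integrable (integrable_fubini_F integrable_N) => // p _; exact: NE.
- rewrite /Rintegral integral_mkcond.
  under eq_integral do rewrite -NE.
  rewrite (Fubini integrable_N).
  under eq_integral do rewrite inner EFinM.
  rewrite integralZl//.
    by rewrite int_oneDsqrV/= mulNr mulrC mulNr.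
  apply/integrableP; split.
    by apply/measurable_EFinP; apply: continuous_measurable_fun; exact: continuous_oneDsqrV.
  under eq_integral do rewrite gee0_abs ?lee_fin ?invr_ge0 ?addr_ge0 ?sqr_ge0//.
  by rewrite int_oneDsqrV ltry.
Qed.

End abel_inversion.

(** * Functions of class C^k on R^n *)

Section matrix_norm.
Context {R : realType} {m n : nat}.

Lemma norm_coord_le (x : 'M[R]_(m, n)) i j : `|x i j| <= `|x|.
Proof.
rewrite [leRHS]/Num.Def.normr/= mx_normrE.
exact: (le_bigmax _ (fun i : 'I_m * 'I_n => `|x i.1 i.2|) (i, j)).
Qed.

Lemma norm_le_coord (x : 'M[R]_(m, n)) e : 0 <= e ->
  (forall i j, `|x i j| <= e) -> `|x| <= e.
Proof.
move=> e0 H; rewrite /Num.Def.normr/= mx_normrE.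
by apply: bigmax_le => // -[i j] _; exact: H.
Qed.

Lemma cvg_coord (T : Type) (F : set_system T) {FF : Filter F}
    (f : T -> 'M[R]_(m, n)) (l : 'M[R]_(m, n)) :
  (forall i j, f x i j @[x --> F] --> l i j) -> f x @[x --> F] --> l.
Proof.
move=> H; apply/cvgrPdist_le => e e0; near=> x.
apply: norm_le_coord; first exact: ltW.
move=> i j; rewrite !mxE.
move: i j; near: x; apply: filter_forall => i; apply: filter_forall => j.
by have /cvgrPdist_le/(_ _ e0) := H i j.
Unshelve. all: by end_near. Qed.

End matrix_norm.

Section line_derivative.
Context {R : numFieldType} {V W : normedModType R}.

Lemma growth_line (f : V -> W) (x v : V) (t : R) :
  (fun h : R => h^-1 *: (f ((h *: (1 : R) + t) *: v + x) - f (t *: v + x))) =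
  (fun h : R => h^-1 *: (f (h *: v + (t *: v + x)) - f (t *: v + x))).
Proof.
apply/funext => h; congr (_ *: (f _ - _)).
have -> : h *: (1 : R) = h by exact: mulr1.
by rewrite scalerDl addrA.
Qed.

Lemma derivable_line (f : V -> W) (x v : V) (t : R) :
  derivable f (t *: v + x) v -> derivable (fun s : R => f (s *: v + x)) t 1.
Proof. by rewrite /derivable growth_line. Qed.

Lemma derive_line (f : V -> W) (x v : V) (t : R) :
  'D_1 (fun s : R => f (s *: v + x)) t = 'D_v f (t *: v + x).
Proof. by rewrite /derive growth_line. Qed.

End line_derivative.

Section C1_differentiable.
Context {R : realType}.

(** The end point [a] may have either sign, whence the symmetric range of [t]. *)
Lemma mean_value_bound (phi : R -> R) (a d : R) :
  (forall t : R, `|t| <= `|a| -> derivable phi t 1 /\ `|'D_1 phi t| <= d) ->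
  `|phi a - phi 0| <= d * `|a|.
Proof.
move=> H; have [a0|a0] := leP 0 a.
  have H1 t : t \in `[0, a] -> derivable phi t 1 /\ `|'D_1 phi t| <= d.
    by rewrite in_itv/= => /andP[t0 ta]; apply: H; rewrite !ger0_norm.
  have [| |c ca ->] := @MVT_segment _ phi (fun t => 'D_1 phi t) 0 a a0.
  - move=> t /subset_itv_oo_cc tI; apply/derivableP; exact: (H1 _ tI).1.
  - by apply: derivable_within_continuous => t tI; exact: (H1 _ tI).1.
  - by rewrite subr0 normrM ler_wpM2r// (H1 _ ca).2.
have H1 t : t \in `[a, 0] -> derivable phi t 1 /\ `|'D_1 phi t| <= d.
  by rewrite in_itv/= => /andP[t0 ta]; apply: H; rewrite !ler0_norm ?lerN2// ltW.
have [| |c ca e] := @MVT_segment _ phi (fun t => 'D_1 phi t) a 0 (ltW a0).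
- move=> t /subset_itv_oo_cc tI; apply/derivableP; exact: (H1 _ tI).1.
- by apply: derivable_within_continuous => t tI; exact: (H1 _ tI).1.
- by rewrite distrC e sub0r normrM normrN ler_wpM2r// (H1 _ ca).2.
Qed.

(** Change the coordinates of [x] into those of [v + x] one at a time and apply
    the mean value inequality to each step. *)
Lemma small_partials_bound n (g : 'rV[R]_n -> R) (x : 'rV[R]_n) (d r : R) :
  (forall y, `|y - x| < r -> forall j, derivable g y (delta_mx 0 j) /\
     `|'D_(delta_mx 0 j) g y| <= d) ->
  forall v, `|v| < r -> `|g (v + x) - g x| <= (d * `|v|) *+ n.
Proof.
move=> H v vr.
pose w (k : nat) : 'rV[R]_n := x + \row_j (if (j < k)%N then v 0 j else 0).
have wn : w n = v + x.
  by rewrite addrC; congr (_ + _); apply/rowP => j; rewrite mxE ltn_ord.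
have w0 : w 0%N = x.
  by rewrite /w (_ : \row__ _ = 0) ?addr0//; apply/rowP => j; rewrite !mxE.
have -> : g (v + x) - g x = \sum_(0 <= k < n) (g (w k.+1) - g (w k)).
  by rewrite (telescope_sumr (fun k => g (w k)))// wn w0.
rewrite big_mkord.
apply: le_trans (ler_norm_sum _ _ _) _.
apply: (@le_trans _ _ (\sum_(k < n) d * `|v|)); last first.
  by rewrite sumr_const card_ord.
apply: ler_sum => k _.
have wS : w k.+1 = v 0 k *: delta_mx 0 k + w k.
  rewrite /w addrCA; congr (_ + _); apply/rowP => j; rewrite !mxE/= ltnS leq_eqVlt.
  have [->|jk] := eqVneq j k; first by rewrite eqxx ltnn mulr1 addr0.
  by rewrite (_ : (j == k :> nat) = false) ?mulr0 ?add0r//; exact: negbTE.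
pose phi t := g (t *: delta_mx 0 k + w k).
have -> : g (w k.+1) - g (w k) = phi (v 0 k) - phi 0.
  by rewrite /phi wS scale0r add0r.
apply: (@le_trans _ _ (d * `|v 0 k|)).
  apply: mean_value_bound => t tv.
  have [|h1 h2] := H (t *: delta_mx 0 k + w k) _ k.
    have -> : t *: delta_mx 0 k + w k - x =
        t *: delta_mx 0 k + \row_j (if (j < k)%N then v 0 j else 0).
      by rewrite /w [x + _]addrC addrA addrK.
    apply: le_lt_trans vr; apply: norm_le_coord => // i j.
    rewrite !ord1 !mxE/=.
    have [->|jk] := eqVneq j k.
      by rewrite ltnn mulr1 addr0 (le_trans tv)// norm_coord_le.
    by rewrite mulr0 add0r; case: ifPn; rewrite ?normr0// norm_coord_le.
  split; first exact: derivable_line.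
  by rewrite derive_line.
rewrite ler_wpM2l//; last exact: norm_coord_le.
have [|_ /(le_trans _)] := H x _ k; last by apply.
by rewrite subrr normr0 (le_lt_trans _ vr).
Qed.

Lemma differentiable_flat (V W : normedModType R) (g : V -> W) (x : V) :
  (forall e, 0 < e -> \forall v \near (0 : V), `|g (v + x) - g x| <= e * `|v|) ->
  differentiable g x.
Proof.
move=> H.
pose z : {linear V -> W} := \0.
have E : g \o shift x = cst (g x) + z +o_ (0 : V) id.
  apply/eqaddoP => e e0; near=> v.
  rewrite /= !fctE /=.
  rewrite addr0; near: v; exact: H.
apply/diff_locallyP; rewrite (@diff_unique _ _ _ g z x _ E)//.
  by split => //; exact: cst_continuous.
exact: cst_continuous.
Unshelve. all: by end_near. Qed.

Lemma derive_coord m n (x v : 'M[R]_(m, n)) i j :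
  is_derive x v (fun y : 'M[R]_(m, n) => y i j) (v i j).
Proof.
have d : forall i j, derivable (fun y : 'M[R]_(m, n) => y i j) x v.
  by apply/derivable_mxP; exact: derivable_id.
split => //.
have := derive_mx (@derivable_id _ _ x v).
by rewrite derive_id => /matrixP/(_ i j); rewrite mxE.
Qed.

(** Subtract from [f] the linear form with the same partial derivatives at [x]:
    the partial derivatives of the difference are small near [x], so
    [small_partials_bound] makes the difference negligible at first order. *)
Lemma C1_differentiable n (f : 'rV[R]_n -> R) (U : set 'rV[R]_n) x :
  open U -> U x ->
  (forall i y, U y -> derivable f y (delta_mx 0 i)) ->
  (forall i, {for x, continuous (fun y => 'D_(delta_mx 0 i) f y)}) ->
  differentiable f x.
Proof.
move=> oU Ux df cf.
pose a i := 'D_(delta_mx 0 i) f x.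
pose L : 'rV[R]_n -> R := \sum_i (a i *: (fun y : 'rV[R]_n => y 0 i)).
have dL : differentiable L x.
  by apply: differentiable_sum => i; apply: differentiableZ; exact: differentiable_coord.
have DL y j : is_derive y (delta_mx 0 j) L (a j).
  have ? := fun i => derive_coord y (delta_mx 0 j) 0 i.
  apply: is_derive_eq.
  rewrite (bigD1 j)//= mxE !eqxx /= big1 ?addr0; first exact: mulr1.
  by move=> i ij; rewrite mxE (negbTE ij) andbF scaler0.
have -> : f = (f - L) + L by rewrite subrK.
apply: differentiableD => //.
apply: differentiable_flat => e e0.
have e1 : 0 < e / n.+1%:R by rewrite divr_gt0.
have : \forall y \near x, U y /\ forall j, `|a j - 'D_(delta_mx 0 j) f y| <= e / n.+1%:R.
  near=> y; split; first by near: y; exact: open_nbhs_nbhs.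
  near: y; apply: filter_forall => j.
  by have /cvgrPdist_le/(_ _ e1) := cf j.
move=> /nbhs_ballP[r /= r0 rU]; near=> v.
have vr : `|v| < r.
  near: v; apply/nbhs_ballP; exists r => // u.
  by rewrite -ball_normE/= sub0r normrN.
have := @small_partials_bound n (f - L) x (e / n.+1%:R) r _ v vr.
move=> /(_ _)/le_trans -> //.
  move=> y yx j.
  have [|Uy ay] := rU y.
    by rewrite -ball_normE/= distrC.
  have Df := df j y Uy; have dl := DL y j.
  split; first by apply: derivableB => //; exact: ex_derive.
  by rewrite deriveB// (@derive_val _ _ _ _ _ _ _ dl) distrC.
rewrite -[leLHS]mulr_natr mulrAC.
rewrite ler_wpM2r// -mulrA.
rewrite ler_piMr ?(ltW e0)// mulrC ler_pdivrMr// mul1r ler_nat//.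
Unshelve. all: by end_near. Qed.

(** The chain rule in terms of partial derivatives. Along the direction [v] only
    the restriction of [g] to a line matters, so [g] need not be differentiable. *)
Lemma derive_comp_coord (V : normedModType R) n (f : 'rV[R]_n -> R)
    (g : V -> 'rV[R]_n) (x v : V) :
  differentiable f (g x) -> (forall j, derivable (fun y => g y 0 j) x v) ->
  is_derive x v (f \o g)
    (\sum_j 'D_(delta_mx 0 j) f (g x) * 'D_v (fun y => g y 0 j) x).
Proof.
move=> df dg.
pose c (h : R) := g (h *: v + x).
have c0 : c 0 = g x by rewrite /c scale0r add0r.
have dgx : derivable g x v by apply/derivable_mxP => i j; rewrite ord1.
have dc : derivable c 0 1 by exact: (derivable1P g x v).1 dgx.
have dc' : differentiable c 0 by exact/derivable1_diffP.
have dfc : differentiable (f \o c) 0.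
  by apply: differentiable_comp => //; rewrite c0.
have Dc : 'D_1 c 0 = \row_j 'D_v (fun y => g y 0 j) x.
  have := derive_line g x v 0; rewrite scale0r add0r => ->.
  by rewrite (derive_mx dgx); apply/rowP => j; rewrite [LHS]mxE [RHS]mxE.
split; first by apply: (derivable1P (f \o g) x v).2; exact/derivable1_diffP.
have := derive_line (f \o g) x v 0; rewrite scale0r add0r => <-.
have dfc0 : differentiable f (c 0) by rewrite c0.
transitivity ('d f (c 0) ('d c 0 1)).
  have -> : (fun s : R => (f \o g) (s *: v + x)) = f \o c by [].
  by rewrite (deriveE _ dfc) (diff_comp dc' dfc0).
rewrite -(deriveE _ dc') Dc c0.
rewrite [X in 'd f _ X]row_sum_delta linear_sum; apply: eq_bigr => j _.
by rewrite linearZ /= mxE -deriveE// mulrC.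
Qed.

End C1_differentiable.

Section class_C.
Context {R : realType}.

Lemma class_C_continuous n k (U : set 'rV[R]_n) f :
  class_C k U f -> forall x, U x -> {for x, continuous f}.
Proof. by case: k => [|k] []. Qed.

Lemma class_C_sub n k (U V : set 'rV[R]_n) f :
  V `<=` U -> class_C k U f -> class_C k V f.
Proof.
move=> VU; elim: k f => [|k IH] f /= [cf df]; split=> //.
- by move=> x /VU; exact: cf.
- by move=> x /VU; exact: cf.
- by move=> i; have [d1 d2] := df i; split; [move=> x /VU; exact: d1|exact: IH].
Qed.

Lemma class_CS n k (U : set 'rV[R]_n) f : class_C k.+1 U f -> class_C k U f.
Proof.
elim: k f => [|k IH] f [cf df]; split=> // i.
by have [d1 d2] := df i; split=> //; exact: IH.
Qed.

Lemma near_eq_continuous (T S : topologicalType) (f f' : T -> S) x :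
  (\forall y \near x, f y = f' y) -> {for x, continuous f} ->
  {for x, continuous f'}.
Proof.
move=> e; rewrite /prop_for /continuous_at -(nbhs_singleton e) => cf.
by apply: cvg_trans cf; apply: near_eq_cvg.
Qed.

Lemma class_C_ext n k (U : set 'rV[R]_n) f f' : open U ->
  (forall x, U x -> f x = f' x) -> class_C k U f -> class_C k U f'.
Proof.
move=> oU; elim: k f f' => [|k IH] f f' ff' [cf df];
  have nff' x : U x -> \forall y \near x, f y = f' y.
- by move=> Ux; near=> y; apply: ff'; near: y; exact: open_nbhs_nbhs.
- split=> // x Ux; apply: near_eq_continuous (cf x Ux); exact: nff'.
- by move=> Ux; near=> y; apply: ff'; near: y; exact: open_nbhs_nbhs.
- split=> [x Ux|i]; first by apply: near_eq_continuous (cf x Ux); exact: nff'.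
  have [d1 d2] := df i; split.
    by move=> x Ux; apply: near_eq_derivable (d1 x Ux); exact: nff'.
  apply: IH d2 => x Ux; apply: near_eq_derive; exact: nff'.
Unshelve. all: by end_near. Qed.

Lemma class_C_cst n k (U : set 'rV[R]_n) (c : R) : class_C k U (fun=> c).
Proof.
elim: k c => [|k IH] c; split=> //.
- by move=> x _; exact: cst_continuous.
- by move=> x _; exact: cst_continuous.
- move=> i; split; first by move=> x _; exact: derivable_cst.
  rewrite [X in class_C _ _ X](_ : _ = fun=> 0); first exact: IH.
  by apply/funext => x; exact: derive_cst.
Qed.

Lemma class_C_coord n k (U : set 'rV[R]_n) j :
  class_C k U (fun x : 'rV[R]_n => x 0 j).
Proof.
have c : forall x, U x -> {for x, continuous (fun x : 'rV[R]_n => x 0 j)}.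
  by move=> x _; exact: coord_continuous.
case: k => [|k]; split=> // i; split.
  by move=> x _; have d := derive_coord x (delta_mx 0 i) 0 j; exact: ex_derive.
rewrite [X in class_C _ _ X](_ : _ = fun=> (delta_mx 0 i : 'rV[R]_n) 0 j).
  exact: class_C_cst.
by apply/funext => x; have d := derive_coord x (delta_mx 0 i) 0 j; exact: derive_val.
Qed.

Lemma class_CD n k (U : set 'rV[R]_n) f f' : open U ->
  class_C k U f -> class_C k U f' -> class_C k U (fun x => f x + f' x).
Proof.
move=> oU; elim: k f f' => [|k IH] f f' [cf df] [cf' df'].
  by split=> // x Ux; exact: (@continuousD _ _ _ f f' x (cf x Ux) (cf' x Ux)).
split=> [x Ux|i]; first by exact: (@continuousD _ _ _ f f' x (cf x Ux) (cf' x Ux)).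
have [d1 d2] := df i; have [d1' d2'] := df' i; split.
  by move=> x Ux; apply: derivableD; [exact: d1|exact: d1'].
apply: (@class_C_ext _ _ _ (fun x => 'D_(delta_mx 0 i) f x + 'D_(delta_mx 0 i) f' x)) => //.
  by move=> x Ux; apply/esym; apply: deriveD; [exact: d1|exact: d1'].
exact: IH.
Qed.

Lemma class_CM n k (U : set 'rV[R]_n) f f' : open U ->
  class_C k U f -> class_C k U f' -> class_C k U (fun x => f x * f' x).
Proof.
move=> oU; elim: k f f' => [|k IH] f f' Cf Cf'; have [cf df] := Cf; have [cf' df'] := Cf'.
  by split=> // x Ux; exact: (@continuousM _ _ f f' x (cf x Ux) (cf' x Ux)).
split=> [x Ux|i]; first by exact: (@continuousM _ _ f f' x (cf x Ux) (cf' x Ux)).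
have [d1 d2] := df i; have [d1' d2'] := df' i; split.
  by move=> x Ux; apply: derivableM; [exact: d1|exact: d1'].
apply: (@class_C_ext _ _ _ (fun x => f x * 'D_(delta_mx 0 i) f' x + f' x * 'D_(delta_mx 0 i) f x)) => //.
  by move=> x Ux; apply/esym; apply: deriveM; [exact: d1|exact: d1'].
by apply: class_CD => //; apply: IH => //; exact: class_CS.
Qed.

Lemma class_C_sum n k (U : set 'rV[R]_n) m (F : 'I_m -> 'rV[R]_n -> R) : open U ->
  (forall j, class_C k U (F j)) -> class_C k U (fun x => \sum_j F j x).
Proof.
move=> oU; elim: m F => [|m IH] F CF.
  apply: (@class_C_ext _ _ _ (fun=> 0)) => //; last exact: class_C_cst.
  by move=> x _; rewrite big_ord0.
apply: (@class_C_ext _ _ _ (fun x => F ord0 x + \sum_j F (lift ord0 j) x)) => //.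
  by move=> x _; rewrite big_ord_recl.
by apply: class_CD => //; exact: IH.
Qed.

Lemma class_C_differentiable n k (U : set 'rV[R]_n) f x : open U ->
  class_C k.+1 U f -> U x -> differentiable f x.
Proof.
move=> oU [_ df] Ux; apply: (C1_differentiable oU) => //.
  by move=> i; exact: (df i).1.
by move=> i; exact: (class_C_continuous (df i).2).
Qed.

(** By the chain rule a partial derivative of [f \o g] is a sum of products of
    functions to which the induction hypothesis applies. *)
Lemma class_C_comp m n k (U : set 'rV[R]_m) (V : set 'rV[R]_n)
    (g : 'rV[R]_m -> 'rV[R]_n) (f : 'rV[R]_n -> R) :
  open U -> open V -> (forall x, U x -> V (g x)) ->
  (forall j, class_C k U (fun x => g x 0 j)) -> class_C k V f ->
  class_C k U (f \o g).
Proof.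
move=> oU oV gUV.
have cg k' : (forall j, class_C k' U (fun x => g x 0 j)) ->
    forall x, U x -> {for x, continuous g}.
  move=> Cg x Ux; apply: (@cvg_coord _ _ _ _ _ (nbhs_filter x)) => i j; rewrite ord1.
  exact: (class_C_continuous (Cg j) Ux).
elim: k f => [|k IH] f Cg Cf.
  split=> // x Ux; apply: continuous_comp; first exact: (cg _ Cg).
  by apply: (class_C_continuous Cf); exact: gUV.
split=> [x Ux|i].
  apply: continuous_comp; first exact: (cg _ Cg).
  by apply: (class_C_continuous Cf); exact: gUV.
have d x : U x -> is_derive x (delta_mx 0 i) (f \o g)
    (\sum_j 'D_(delta_mx 0 j) f (g x) * 'D_(delta_mx 0 i) (fun y => g y 0 j) x).
  move=> Ux; apply: derive_comp_coord.
    by apply: (class_C_differentiable oV Cf); exact: gUV.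
  by move=> j; have [_ /(_ i)[]] := Cg j => + _; exact.
split; first by move=> x /d ?; exact: ex_derive.
apply: (@class_C_ext _ _ _ (fun x => \sum_j 'D_(delta_mx 0 j) f (g x) * 'D_(delta_mx 0 i) (fun y => g y 0 j) x)) => //.
  by move=> x /d ?; apply/esym; exact: derive_val.
apply: class_C_sum => // j; apply: class_CM => //.
  apply: (IH (fun y => 'D_(delta_mx 0 j) f y)).
    by move=> j'; exact: class_CS.
  by have [_ /(_ j)[]] := Cf.
by have [_ /(_ i)[]] := Cg j.
Qed.

End class_C.

(** * Euclidean geometry of R^n *)

Section euclidean.
Context {R : realType} {n : nat}.
Implicit Types x y z : 'rV[R]_n.

Lemma dotE x y : dot x y = \sum_i x 0 i * y 0 i.
Proof. by rewrite /dot mxE; apply: eq_bigr => i _; rewrite mxE. Qed.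

Lemma dotC x y : dot x y = dot y x.
Proof. by rewrite !dotE; apply: eq_bigr => i _; rewrite mulrC. Qed.

Lemma dotDl x y z : dot (x + y) z = dot x z + dot y z.
Proof. by rewrite /dot mulmxDl mxE. Qed.

Lemma dotZl a x y : dot (a *: x) y = a * dot x y.
Proof. by rewrite /dot -scalemxAl mxE. Qed.

Lemma dotNl x y : dot (- x) y = - dot x y.
Proof. by rewrite -scaleN1r dotZl mulN1r. Qed.

Lemma dotDr x y z : dot z (x + y) = dot z x + dot z y.
Proof. by rewrite !(dotC z) dotDl. Qed.

Lemma dotZr a x y : dot x (a *: y) = a * dot x y.
Proof. by rewrite !(dotC x) dotZl. Qed.

Lemma dotNr x y : dot x (- y) = - dot x y.
Proof. by rewrite !(dotC x) dotNl. Qed.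

Lemma dot_ge0 x : 0 <= dot x x.
Proof. by rewrite dotE; apply: sumr_ge0 => i _; rewrite -expr2 sqr_ge0. Qed.

Lemma dot_eq0 x : dot x x = 0 -> x = 0.
Proof.
rewrite dotE => /eqP; rewrite psumr_eq0; last first.
  by move=> i _; rewrite -expr2 sqr_ge0.
move=> /allP H; apply/rowP => i; rewrite mxE.
by have := H i (mem_index_enum _); rewrite -expr2 sqrf_eq0 => /eqP.
Qed.

Lemma enorm_sqr x : enorm x ^+ 2 = dot x x.
Proof. by rewrite sqr_sqrtr// dot_ge0. Qed.

Lemma enorm_ge0 x : 0 <= enorm x. Proof. exact: sqrtr_ge0. Qed.

Lemma enormN x : enorm (- x) = enorm x.
Proof. by rewrite /enorm dotNl dotNr opprK. Qed.

Lemma enormZ a x : enorm (a *: x) = `|a| * enorm x.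
Proof. by rewrite /enorm dotZl dotZr mulrA -expr2 sqrtrM ?sqr_ge0// sqrtr_sqr. Qed.

Lemma coord_le_enorm x i : `|x 0 i| <= enorm x.
Proof.
rewrite -sqrtr_sqr ler_sqrt ?dot_ge0// dotE (bigD1 i)//= -expr2 lerDl.
by apply: sumr_ge0 => j _; rewrite -expr2 sqr_ge0.
Qed.

Lemma dot_orthogonal x y (u : 'M[R]_n) : u *m u^T = 1%:M ->
  dot (x *m u) (y *m u) = dot x y.
Proof. by move=> uu; rewrite /dot trmx_mul mulmxA -(mulmxA x) uu mulmx1. Qed.

(** The reflection in the hyperplane orthogonal to [x - y] exchanges [x] and
    [y]. *)
Lemma orthogonal_transitive x y : dot x x = dot y y ->
  exists2 w : 'M[R]_n, w *m w^T = 1%:M & y = x *m w.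
Proof.
move=> xy; have [<-|nxy] := eqVneq x y.
  by exists 1%:M; rewrite ?trmx1 ?mulmx1.
pose z := x - y; pose d := dot z z.
have d0 : d != 0.
  by apply: contra nxy => /eqP /dot_eq0/eqP; rewrite subr_eq0.
have zz : z *m z^T = d%:M by rewrite [LHS]mx11_scalar.
pose P := z^T *m z.
have PP : P *m P = d *: P.
  by rewrite /P mulmxA -(mulmxA z^T) zz mul_mx_scalar -scalemxAl.
have PT : P^T = P by rewrite /P trmx_mul trmxK.
exists (1%:M - (2 / d) *: P).
  rewrite [X in _ *m X](_ : _ = 1%:M - (2 / d) *: P); last first.
    by rewrite [LHS]linearB/= linearZ/= PT trmx1.
  rewrite mulmxBl mul1mx mulmxBr mulmx1.
  rewrite -scalemxAl -scalemxAr PP !scalerA.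
  have -> : 2 / d * (2 / d) * d = 2 / d + 2 / d by field.
  by rewrite scalerDl opprB addrK subrK.
rewrite mulmxBr mulmx1 -scalemxAr /P mulmxA.
have -> : x *m z^T = (dot x z)%:M by rewrite [LHS]mx11_scalar.
rewrite mul_scalar_mx scalerA.
have -> : 2 / d * dot x z = 1.
  have -> : dot x z = d / 2.
    by rewrite /d /z !(dotDl, dotDr, dotNl, dotNr) -xy (dotC y x); field.
  by field.
by rewrite scale1r /z opprB addrC subrK.
Qed.

End euclidean.

Lemma norm_le_enorm (R : realType) n (x : 'rV[R]_n) : `|x| <= enorm x.
Proof.
by apply: norm_le_coord => [|i j]; rewrite ?enorm_ge0// ord1 coord_le_enorm.
Qed.

Lemma enorm_le_norm (R : realType) n (x : 'rV[R]_n) : enorm x <= n%:R * `|x|.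
Proof.
rewrite -[leRHS]ger0_norm ?mulr_ge0// -sqrtr_sqr ler_wsqrtr// dotE.
apply: (@le_trans _ _ (\sum_(i < n) `|x| ^+ 2)).
  apply: ler_sum => i _; rewrite -expr2 -[leLHS]real_normK ?num_real//.
  by rewrite lerXn2r ?nnegrE// norm_coord_le.
rewrite sumr_const card_ord -[leLHS]mulr_natl exprMn ler_wpM2r ?sqr_ge0//.
by rewrite -natrX ler_nat -mulnn; case: n x => // n _; rewrite leq_pmulr.
Qed.

Section isometric_curves.
Context {R : realType}.

(** The derivative is locally constant, hence constant. *)
Lemma locally_affine (phi : R -> R) :
  (forall t, exists v, \forall s \near t, phi s = phi t + (s - t) * v) ->
  exists v, forall s, phi s = phi 0 + s * v.
Proof.
move=> H.
have aff (a b t v : R) : is_derive t (1 : R) (fun s : R => a + (s - b) * v) v.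
  apply: is_derive_eq.
  by rewrite scaler0 !add0r subr0 mul1r; exact: mulr1.
have dphi t v : (\forall s \near t, phi s = phi t + (s - t) * v) ->
    \forall s \near t, is_derive s (1 : R) phi v.
  move=> /near_join; apply: filterS => s Hs.
  apply: (near_eq_is_derive _ (aff (phi t) t s v)).
  by apply: filterS Hs => ? ->.
have dD t : is_derive t (1 : R) (fun s : R => 'D_1 phi s) 0.
  have [v /dphi Hv] := H t.
  apply: (@near_eq_is_derive _ _ _ (cst v)).
  by apply: filterS Hv => s ds; rewrite derive_val.
have Dc s : 'D_1 phi s = 'D_1 phi 0 by apply: (@is_derive_0_is_cst _ (fun s => 'D_1 phi s)).
exists ('D_1 phi 0) => s.
have d0 t : is_derive t (1 : R) (fun s : R => phi s - s * 'D_1 phi 0) 0.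
  have dt : is_derive t (1:R) phi ('D_1 phi 0).
    by have [v /dphi/nbhs_singleton Hv] := H t; rewrite -(Dc t); apply/derivableP; exact: ex_derive.
  apply: is_derive_eq.
  rewrite scaler0 add0r.
  by rewrite [X in _ - X]mulr1 subrr.
have := is_derive_0_is_cst s 0 d0.
by rewrite mul0r subr0 => <-; rewrite subrK.
Qed.

(** The three mutual distances of [c t], [c s'] and [c s] determine the scalar
    product of [c s - c t] and [c s' - c t], and it is the one of the equality
    case of the Cauchy-Schwarz inequality, so [c s] lies on the line through
    [c t] and [c s']. *)
Lemma isometric_curve_affine n (c : R -> 'rV[R]_n) :
  (forall t, exists2 e : R, 0 < e & forall s s', `|s - t| < e -> `|s' - t| < e ->
     enorm (c s - c s') = `|s - s'|) ->
  exists2 v, enorm v = 1 & forall t, c t = c 0 + t *: v.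
Proof.
move=> H.
have loc t : exists v, \forall s \near t, c s = c t + (s - t) *: v.
  have [e e0 He] := H t.
  have dE s s' : `|s - t| < e -> `|s' - t| < e ->
      dot (c s - c s') (c s - c s') = (s - s') ^+ 2.
    by move=> h1 h2; rewrite -enorm_sqr He// real_normK// num_real.
  have tt : `|t - t| < e by rewrite subrr normr0.
  (* any fixed parameter other than [t] in the interval would do *)
  pose s' := t + e / 2.
  have e2 : e / 2 != 0 by rewrite gt_eqF// divr_gt0.
  have s't : `|s' - t| < e.
    rewrite /s' addrAC subrr add0r ger0_norm ?divr_ge0 ?ltW//.
    by rewrite ltr_pdivrMr// ltr_pMr// ltr1n.
  exists ((e / 2)^-1 *: (c s' - c t)).
  apply/nbhs_ballP; exists e => // s; rewrite /ball/= distrC => st.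
  apply/eqP; rewrite addrC -subr_eq; apply/eqP.
  set a := c s - c t; set b := c s' - c t.
  have aa : dot a a = (s - t) ^+ 2 by exact: dE.
  have bb : dot b b = (s' - t) ^+ 2 by exact: dE.
  have ab : dot (a - b) (a - b) = (s - s') ^+ 2.
    by rewrite -dE// /a /b opprB addrA subrK.
  have sE : s' - t = e / 2 by rewrite /s' addrAC subrr add0r.
  clearbody a b.
  suff : (e / 2) *: a - (s - t) *: b = 0.
    move/eqP; rewrite subr_eq0 => /eqP h.
    by rewrite scalerA mulrC -scalerA -h scalerA mulVf// scale1r.
  apply: dot_eq0.
  rewrite !(dotDl, dotDr, dotNl, dotNr, dotZl, dotZr) (dotC b a).
  move: ab; rewrite !(dotDl, dotDr, dotNl, dotNr) (dotC b a) aa bb => ab.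
  have -> : dot a b = (s - t) * (s' - t).
    move: ab; have -> : s - s' = (s - t) - (s' - t) by rewrite opprB addrA subrK.
    by move: (s - t) (s' - t) => p q pq; lra.
  by rewrite sE; ring.
have cj j : exists v, forall s, c s 0 j = c 0 0 j + s * v.
  apply: (locally_affine (phi := fun s => c s 0 j)) => t.
  have [v Hv] := loc t; exists (v 0 j).
  by apply: filterS Hv => s ->; rewrite !mxE.
have [w Hw] := choice cj.
have cE t : c t = c 0 + t *: \row_j w j.
  by apply/rowP => j; rewrite Hw !mxE.
exists (\row_j w j) => //.
have [e e0 He] := H 0.
have h2 : `|e / 2 - 0| < e.
  rewrite subr0 ger0_norm ?divr_ge0 ?ltW//.
  by rewrite ltr_pdivrMr// ltr_pMr// ltr1n.
have h0 : `|(0 : R) - 0| < e by rewrite subr0 normr0.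
have := He _ _ h2 h0; rewrite subr0.
have -> : c (e / 2) - c 0 = (e / 2) *: \row_j w j.
  by rewrite (cE (e / 2)) addrC addKr.
rewrite enormZ.
move=> /eqP; rewrite -subr_eq0 -{2}[`|_|]mulr1 -mulrBr mulf_eq0 normr_eq0.
by rewrite gt_eqF ?divr_gt0//= subr_eq0 => /eqP.
Qed.

End isometric_curves.

(** * Borel measurability and product measures *)

Section second_countable.
Context {R : realType}.

Lemma second_countable_dense (T : normedModType R) (I : countType) (D : I -> T) :
  (forall x e, 0 < e -> exists i, ball (D i) e x) -> @second_countable T.
Proof.
move=> H.
(* a ball of radius 1/(k+1) that contains x lies in the ball of radius 2/(k+1)
   around x *)
pose B (q : I * nat) : set T := ball (D q.1) q.2.+1%:R^-1.
exists (range B).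
  by apply: sub_countable (card_image_le _ _) _; exact: countableP.
split=> [_ [q _ <-]|x A].
  by apply: ball_open; rewrite invr_gt0.
move=> /nbhs_ballP[r /= r0 xrA].
have [k kr] : exists k : nat, (k.+1%:R^-1 : R) + k.+1%:R^-1 <= r.
  have := near_infty_natSinv_lt (PosNum (divr_gt0 r0 (@ltr0Sn _ 1))).
  move=> [k _ /(_ k (leqnn k))/= kr]; exists k.
  by rewrite [leRHS]splitr lerD// ltW.
have k0 : 0 < k.+1%:R^-1 :> R by rewrite invr_gt0.
have [q qx] := H x _ k0.
exists (B (q, k)); first by split; [exists (q, k)|].
move=> y /= qy; apply: xrA; apply: le_ball kr _ _.
by apply: ball_triangle qy; exact: ball_sym.
Qed.

Let ball_rat (x e : R) : 0 < e -> exists q : rat, ball (ratr q : R) e x.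
Proof.
move=> e0; have [| |y [xy [q _ qy]]] := @dense_rat R (ball x e).
- by exists x; exact: ballxx.
- exact: ball_open.
- by exists q; rewrite qy; exact: ball_sym.
Qed.

Lemma second_countable_matrix m n : @second_countable 'M[R]_(m, n).
Proof.
apply: (@second_countable_dense _ _
  (fun q : 'M[rat]_(m, n) => \matrix_(i, j) (ratr (q i j) : R))) => x e e0.
have H i j := ball_rat (x i j) e0.
exists (\matrix_(i, j) sval (cid (H i j))); split=> // i j.
by rewrite !mxE; exact: svalP (cid (H i j)).
Qed.

Lemma second_countable_R : @second_countable R.
Proof. exact: (@second_countable_dense R^o _ ratr) ball_rat. Qed.

End second_countable.

Lemma bigcup_countable_measurable d (T : sigmaRingType d) (I : Type)
    (D : set I) (F : I -> set T) : countable D ->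
  (forall i, D i -> measurable (F i)) -> measurable (\bigcup_(i in D) F i).
Proof.
have [->|/set0P[r Dr]] := eqVneq D set0; first by rewrite bigcup_set0.
move=> /countable_injP[f injf] mF.
rewrite -(injpinv_image (cst r) injf) bigcup_image.
apply: bigcup_measurable => _ /= [s Ds <-].
by rewrite pinvKV ?inE//; exact: mF.
Qed.

(** Stated with the open sets of the target, because on a product of topological
    spaces the Borel sigma-algebra and the product of the Borel sigma-algebras
    are two distinct structures. *)
Definition borel_fun d (Omega : measurableType d) (T : topologicalType)
  (i : Omega -> T) := forall U, open U -> measurable (i @^-1` U).

Section borel_fun.
Context d (Omega : measurableType d).

Lemma borel_fun_comp (S T : topologicalType) (i : Omega -> S) (g : S -> T) :
  continuous g -> borel_fun i -> borel_fun (g \o i).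
Proof.
move=> /continuousP cg mi U oU; rewrite comp_preimage; apply: mi; exact: cg.
Qed.

(** By second countability an open set of [S * T] is a countable union of open
    rectangles. *)
Lemma borel_fun_pair (S T : topologicalType) (i : Omega -> S) (j : Omega -> T) :
  @second_countable S -> @second_countable T ->
  borel_fun i -> borel_fun j -> borel_fun (fun w => (i w, j w)).
Proof.
move=> [B cB [oB nB]] [C cC [oC nC]] mi mj W oW.
pose D := [set UV : set S * set T | [/\ B UV.1, C UV.2 & UV.1 `*` UV.2 `<=` W]].
have cD : countable D.
  apply: sub_countable (countableX cB cC).
  by apply: subset_card_le => -[U V] [].
have -> : (fun w => (i w, j w)) @^-1` W =
    \bigcup_(UV in D) (i @^-1` UV.1 `&` j @^-1` UV.2).
  apply/seteqP; split=> w /=; last first.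
    by move=> [[U V] [BU CV UVW] [/= iU jV]]; apply: UVW.
  move=> Ww; have : nbhs (i w, j w) W by exact: open_nbhs_nbhs.
  move=> [[U V] /= [/nB[U' /= [BU' U'i] U'U] /nC[V' /= [CV' V'j] V'V]] UVW].
  exists (U', V') => //; split=> //= -[a b] /= [Ua Vb]; apply: UVW; split.
    exact: U'U.
  exact: V'V.
apply: bigcup_countable_measurable => // -[U V] [/= BU CV _].
by apply: measurableI; [apply: mi; exact: oB|apply: mj; exact: oC].
Qed.

Lemma borel_fun_measurable (R : realType) (f : Omega -> R) :
  borel_fun f -> measurable_fun setT f.
Proof.
move=> mf; apply: (measurability _ (RGenOpens.measurableE R)).
move=> _ [_ [a [b ->] <-]]; rewrite setTI; apply: mf; exact: interval_open.
Qed.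

Lemma measurable_borel_fun (R : realType) (f : Omega -> R) :
  measurable_fun setT f -> borel_fun f.
Proof.
by move=> mf U oU; rewrite -[_ @^-1` _]setTI; apply: mf => //; exact: open_measurable.
Qed.

Lemma borel_fun_idE (T : ptopologicalType) (i : Omega -> borel T) :
  measurable_fun setT i <-> borel_fun (i : Omega -> T).
Proof.
split=> [mi U oU|mi].
  by rewrite -[_ @^-1` _]setTI; apply: mi => //; exact: sub_sigma_algebra.
apply: (@measurability _ _ _ _ _ i (@open T)) => //.
by move=> _ [U oU <-]; rewrite setTI; exact: mi.
Qed.

End borel_fun.

Lemma borel_fun_id (T : ptopologicalType) : borel_fun (id : borel T -> T).
Proof. by move=> U oU; exact: sub_sigma_algebra. Qed.

Lemma borel_fun_prod (S T : ptopologicalType) :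
  @second_countable S -> @second_countable T ->
  borel_fun (fun z : borel S * borel T => ((z.1 : S), (z.2 : T))).
Proof.
move=> cS cT; apply: borel_fun_pair => //.
- by apply/borel_fun_idE; exact: measurable_fst.
- by apply/borel_fun_idE; exact: measurable_snd.
Qed.

Lemma measurable_borel_comp (S T : ptopologicalType) (g : S -> T) :
  continuous g -> measurable_fun [set: borel S] (g : borel S -> borel T).
Proof.
by move=> cg; apply/borel_fun_idE; exact: (borel_fun_comp cg (@borel_fun_id S)).
Qed.

Lemma probability_lty d (T : measurableType d) (R : realType)
  (P : probability T R) (D : set T) : measurable D -> (P D < +oo)%E.
Proof. by move=> mD; rewrite (le_lt_trans (probability_le1 P mD))// ltry. Qed.

Lemma integrable_bounded d (T : measurableType d) (R : realType)
    (P : {measure set T -> \bar R}) (D : set T) (f : T -> R) M :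
  measurable D -> (P D < +oo)%E -> measurable_fun D f ->
  (forall x, D x -> `|f x| <= M) -> P.-integrable D (EFin \o f).
Proof.
move=> mD PD mf fM; apply: measurable_bounded_integrable => //.
exists M; split; first exact: num_real.
by move=> y My x Dx; apply: (le_trans (fM x Dx)); exact: ltW.
Qed.

(** * The Haar measure of O(l) *)

Section orthogonal_group.
Context {R : realType}.

Lemma continuous_trmx m n : continuous (fun u : 'M[R]_(m, n) => u^T).
Proof.
move=> u; apply: (@cvg_coord _ _ _ _ _ (nbhs_filter u)) => i j.
rewrite mxE; under eq_fun do rewrite mxE; exact: coord_continuous.
Qed.

Lemma continuous_mulmx (T : topologicalType) m n p
    (f : T -> 'M[R]_(m, n)) (g : T -> 'M[R]_(n, p)) x :
  {for x, continuous f} -> {for x, continuous g} ->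
  {for x, continuous (fun x => f x *m g x)}.
Proof.
move=> cf cg; apply: (@cvg_coord _ _ _ _ _ (nbhs_filter x)) => i j.
rewrite mxE; under eq_fun do rewrite mxE.
apply: cvg_big => // [|k _].
  by apply: add_continuous.
apply: cvgM.
  apply: (@continuous_comp _ _ _ f (fun A : 'M[R]_(m, n) => A i k)); first exact: cf.
  exact: coord_continuous.
apply: (@continuous_comp _ _ _ g (fun A : 'M[R]_(n, p) => A k j)); first exact: cg.
exact: coord_continuous.
Qed.

Context {l : nat}.
Local Notation O := (@orthogonal_group R l).

Lemma orthogonal_inv (u : 'M[R]_l) : O u -> u^T *m u = 1%:M.
Proof. by move=> uu; exact: mulmx1C. Qed.

Lemma orthogonal_tr (u : 'M[R]_l) : O u -> O u^T.
Proof. by move=> uu; rewrite /orthogonal_group/= trmxK; exact: orthogonal_inv. Qed.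

Lemma measurable_orthogonal : measurable (O : set (borel 'M[R]_l)).
Proof.
rewrite -(setCK (O)); apply: measurableC; apply: sub_sigma_algebra.
apply/closed_openC.
have -> : O = (fun u : 'M[R]_l => u *m u^T) @^-1` [set 1%:M].
  by apply/seteqP; split.
apply: (@closed_comp 'M[R]_l 'M[R]_l).
  move=> u _; apply: continuous_mulmx; first exact: cvg_id.
  exact: continuous_trmx.
by apply: accessible_closed_set1; apply: hausdorff_accessible; exact: norm_hausdorff.
Qed.

Lemma continuous_mull k (w : 'M[R]_(k, l)) : continuous (fun u : 'M[R]_l => w *m u).
Proof.
move=> u; apply: (@continuous_mulmx _ _ _ _ (fun=> w) id u).
  exact: cst_continuous.
exact: cvg_id.
Qed.

End orthogonal_group.

Section left_translation.
Context {R : realType} {l : nat}.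
Variable mu : probability (borel 'M[R]_l) R.
Hypothesis haar : haar_probability (@mulmx R l l l) (@orthogonal_group R l) mu.
Local Notation O := (@orthogonal_group R l).

(** The preimage of [A] under [w] is its image under [w^T]. *)
Lemma haar_pushforward (w : 'M[R]_l) (A : set (borel 'M[R]_l)) : O w ->
  measurable A -> mu ((fun u : 'M[R]_l => w *m u) @^-1` A) = mu A.
Proof.
move=> Ow mA.
have [_ inv] := haar.
rewrite -(inv w^T (orthogonal_tr Ow) A mA); congr (mu _).
apply/seteqP; split=> [u /= Au|_ [v Av <-]] /=.
  by exists (w *m u) => //; rewrite mulmxA orthogonal_inv// mul1mx.
by rewrite mulmxA Ow mul1mx.
Qed.

Lemma integral_translate (phi : 'M[R]_l -> R) M (w : 'M[R]_l) : O w ->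
  continuous phi -> (forall u, `|phi u| <= M) ->
  \int[mu]_(u in (O : set (borel 'M[R]_l))) phi (w *m u) =
  \int[mu]_(u in (O : set (borel 'M[R]_l))) phi u.
Proof.
move=> Ow cphi bphi; rewrite /Rintegral; congr fine.
have mphi : measurable_fun [set: borel 'M[R]_l] (phi : borel 'M[R]_l -> R).
  apply: borel_fun_measurable.
  exact: (borel_fun_comp cphi (@borel_fun_id 'M[R]_l)).
have mL := measurable_borel_comp (@continuous_mull R l l w).
have OE : O = (fun u : 'M[R]_l => w *m u) @^-1` O.
  apply/seteqP; split=> u /=; rewrite /orthogonal_group/=.
    by move=> uu; rewrite trmx_mul mulmxA -(mulmxA w) uu mulmx1.
  rewrite trmx_mul mulmxA -(mulmxA w) => wuw.
  have := congr1 (fun A => w^T *m A *m w) wuw.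
  by rewrite !mulmxA orthogonal_inv// mul1mx mulmx1 -mulmxA orthogonal_inv// mulmx1.
rewrite [in LHS]OE.
have := @integral_pushforward _ _ _ _ R _ mL mu O (EFin \o phi) _ _ measurable_orthogonal.
move=> <- //.
- apply: eq_measure_integral => A mA _.
  exact: haar_pushforward.
- exact/measurable_EFinP.
- rewrite -OE; apply: (@integrable_bounded _ _ _ mu _ _ M) => //.
  - exact: measurable_orthogonal.
  - by apply: probability_lty; exact: measurable_orthogonal.
  by apply: measurable_funTS; exact: (measurableT_comp mphi mL).
Qed.

End left_translation.

Section Rintegral_prod.
Context d1 d2 (T1 : measurableType d1) (T2 : measurableType d2) (R : realType).
Variable m1 : {sigma_finite_measure set T1 -> \bar R}.
Variable m2 : {sigma_finite_measure set T2 -> \bar R}.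
Variables (A : set T1) (B : set T2) (F : T1 * T2 -> R).
Hypotheses (mA : measurable A) (mB : measurable B).
Hypothesis iF : (m1 \x m2)%E.-integrable (A `*` B) (EFin \o F).

Lemma Rintegral_prod1 :
  (forall x, A x -> m2.-integrable B (fun y => (F (x, y))%:E)) ->
  \int[(m1 \x m2)%E]_(z in A `*` B) F z = \int[m1]_(x in A) \int[m2]_(y in B) F (x, y).
Proof.
move=> iB; rewrite /Rintegral; congr fine.
rewrite integral_mkcond -integral12_prod_meas1; last first.
  by apply/(integrable_mkcond _ (measurableX mA mB)).
rewrite [RHS]integral_mkcond; apply: eq_integral => x _.
rewrite /fubini_F patchE; case: ifPn => xA.
  rewrite fineK; last by apply: integrable_fin_num => //; apply: iB; rewrite -inE.
  rewrite [RHS]integral_mkcond; apply: eq_integral => y _.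
  rewrite !patchE; congr (if _ then _ else _).
  by apply/idP/idP; rewrite !inE; [case|move=> h; split=> //=; rewrite -inE].
rewrite -[RHS](@integral0 _ _ _ m2 setT); apply: eq_integral => y _.
rewrite patchE ifN// notin_setE => -[/= Ax _].
by move: xA; rewrite notin_setE.
Qed.

Lemma Rintegral_prod2 :
  (forall y, B y -> m1.-integrable A (fun x => (F (x, y))%:E)) ->
  \int[(m1 \x m2)%E]_(z in A `*` B) F z = \int[m2]_(y in B) \int[m1]_(x in A) F (x, y).
Proof.
move=> iA; rewrite /Rintegral; congr fine.
rewrite integral_mkcond -integral21_prod_meas1; last first.
  by apply/(integrable_mkcond _ (measurableX mA mB)).
rewrite [RHS]integral_mkcond; apply: eq_integral => y _.
rewrite /fubini_G patchE; case: ifPn => yB.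
  rewrite fineK; last by apply: integrable_fin_num => //; apply: iA; rewrite -inE.
  rewrite [RHS]integral_mkcond; apply: eq_integral => x _.
  rewrite !patchE; congr (if _ then _ else _).
  by apply/idP/idP; rewrite !inE; [case|move=> h; split=> //=; rewrite -inE].
rewrite -[RHS](@integral0 _ _ _ m1 setT); apply: eq_integral => x _.
rewrite patchE ifN// notin_setE => -[/= _ By].
by move: yB; rewrite notin_setE.
Qed.

(** A real-valued inner integral may differ from the extended one where the
    latter is infinite; integrability of all sections excludes this. *)
Lemma integrable_Rintegral_prod : (forall x, A x -> m2.-integrable B (fun y => (F (x, y))%:E)) ->
  m1.-integrable A (fun x => (\int[m2]_(y in B) F (x, y))%:E).
Proof.
move=> iB.
have := integrable_fubini_F ((integrable_mkcond _ (measurableX mA mB)).1 iF).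
move=> /(integrableS measurableT mA (@subsetT _ _)).
apply: eq_integrable => // x; rewrite inE => Ax.
rewrite /Rintegral fineK; last by apply: integrable_fin_num => //; exact: iB.
rewrite /fubini_F [RHS]integral_mkcond; apply: eq_integral => y _.
rewrite !patchE; congr (if _ then _ else _).
by apply/idP/idP; rewrite !inE; [case|move=> h; split].
Qed.

End Rintegral_prod.

Lemma integrable_bounded_slab d1 d2 (T1 : measurableType d1) (T2 : measurableType d2)
    (R : realType) (m1 : {sigma_finite_measure set T1 -> \bar R})
    (m2 : {sigma_finite_measure set T2 -> \bar R}) (A : set T1) (I : set T2)
    (F : T1 * T2 -> R) (M : R) :
  measurable A -> (m1 A < +oo)%E -> measurable I -> (m2 I < +oo)%E ->
  measurable_fun setT F -> (forall z, `|F z| <= M) ->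
  (forall x y, A x -> ~ I y -> F (x, y) = 0) ->
  (m1 \x m2)%E.-integrable (A `*` [set: T2]) (EFin \o F).
Proof.
move=> mA A_fin mI I_fin mF FM F0.
have mAT : measurable (A `*` [set: T2]) by exact: measurableX.
have iF : (m1 \x m2)%E.-integrable (A `*` I) (EFin \o F).
  apply: (@integrable_bounded _ _ _ _ _ _ M).
  - exact: measurableX.
  - apply: (@eq_ind_r _ _ (fun a => a < +oo)%E _ _ (product_measure1E m1 m2 mA mI)).
    by rewrite lte_mul_pinfty// ge0_fin_numE.
  - exact: measurable_funTS.
  - by move=> z _; exact: FM.
apply/(integrable_mkcond _ mAT).
move/(integrable_mkcond _ (measurableX mA mI)) : iF.
apply: eq_integrable => // -[x y] _; rewrite !patchE.
have [Ax|Ax] := pselect (A x); last first.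
  by rewrite !ifN// notin_setE => -[].
have [Iy|Iy] := pselect (I y).
  by rewrite !mem_set.
rewrite memNset; last by case.
by rewrite mem_set//= F0.
Qed.

Section haar_orthogonal.
Context {R : realType} {l : nat}.
Variable mu : probability (borel 'M[R]_l) R.
Hypothesis haar : haar_probability (@mulmx R l l l) (@orthogonal_group R l) mu.
Local Notation O := (@orthogonal_group R l : set (borel 'M[R]_l)).

(** On O(l) the transpose is the inverse, so this is invariance under inversion,
    deduced from left invariance: integrate [phi (y^T *m x)] over both variables.
    Translating [x] gives the integral of [phi x]; translating [y] in
    [phi ((x^T *m y)^T)] gives the integral of [phi x^T]. *)
Lemma integral_transpose (phi : 'M[R]_l -> R) M :
  continuous phi -> (forall u, `|phi u| <= M) ->
  \int[mu]_(u in O) phi u^T = \int[mu]_(u in O) phi u.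
Proof.
move=> cphi bphi.
have mO := @measurable_orthogonal R l.
have cF : continuous (fun z : 'M[R]_l * 'M[R]_l => phi (z.1^T *m z.2)).
  move=> z; apply: (@continuous_comp _ _ _ (fun z : 'M[R]_l * 'M[R]_l => z.1^T *m z.2) phi); last exact: cphi.
  apply: continuous_mulmx; last exact: cvg_snd.
  apply: (@continuous_comp _ _ _ fst trmx); first exact: cvg_fst.
  exact: continuous_trmx.
have mF : measurable_fun [set: borel 'M[R]_l * borel 'M[R]_l]
    (fun z : borel 'M[R]_l * borel 'M[R]_l => phi (z.1^T *m z.2)).
  apply: borel_fun_measurable.
  have sc := @second_countable_matrix R l l.
  exact: (borel_fun_comp cF (borel_fun_prod sc sc)).
have iF : (mu \x mu)%E.-integrable (O `*` O)
    (EFin \o (fun z : borel 'M[R]_l * borel 'M[R]_l => phi (z.1^T *m z.2))).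
  apply: (@integrable_bounded _ _ _ _ _ _ M) => //.
  - exact: measurableX.
  - by apply: (@probability_lty _ _ _ ((mu \x mu)%E : probability _ R)); exact: measurableX.
  exact: measurable_funTS.
have mphi g : continuous g -> mu.-integrable O (fun y => (phi (g y))%:E).
  move=> cg; apply: (@integrable_bounded _ _ _ mu _ _ M) => //.
    exact: probability_lty.
  apply: measurable_funTS; apply: borel_fun_measurable.
  apply: (borel_fun_comp cphi); apply: (borel_fun_comp cg).
  exact: borel_fun_id.
have E1 : \int[mu]_(y in O) \int[mu]_(x in O) phi (y^T *m x) = \int[mu]_(x in O) phi x.
  transitivity (\int[mu]_(y in O) \int[mu]_(x in O) phi x).
    apply: eq_Rintegral => y; rewrite inE => Oy.
    apply: (@integral_translate _ _ _ haar _ M) => //; exact: orthogonal_tr.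
  rewrite Rintegral_cst// [X in fine X](_ : _ = 1%E) ?mulr1//.
  exact: haar.1.
have E2 : \int[mu]_(x in O) \int[mu]_(y in O) phi (y^T *m x) = \int[mu]_(x in O) phi x^T.
  transitivity (\int[mu]_(y in O) \int[mu]_(x in O) phi x^T).
    apply: eq_Rintegral => y; rewrite inE => Oy.
    have cphiT : continuous (fun u : 'M[R]_l => phi u^T).
      by move=> u; apply: continuous_comp; [exact: continuous_trmx|exact: cphi].
    rewrite -(@integral_translate _ _ _ haar _ M y^T _ cphiT)//; last exact: orthogonal_tr.
    by apply: eq_Rintegral => x _; rewrite trmx_mul trmxK.
  rewrite Rintegral_cst// [X in fine X](_ : _ = 1%E) ?mulr1//.
  exact: haar.1.
rewrite -E1 -E2.
have := @Rintegral_prod1 _ _ _ _ _ mu mu _ _ _ mO mO iF.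
have := @Rintegral_prod2 _ _ _ _ _ mu mu _ _ _ mO mO iF.
move=> -> /=; last first.
  move=> y _; apply: (mphi (fun x => x^T *m y)) => x.
  by apply: continuous_mulmx; [exact: continuous_trmx|exact: cst_continuous].
apply => x _; apply: (mphi (fun y => x^T *m y)) => y.
exact: continuous_mull.
Qed.

(** Inversion turns [x *m u^T] into [x *m u], and an orthogonal matrix taking [x]
    to [y] is then absorbed by left invariance. *)
Lemma integral_orthogonal_radial (phi : 'rV[R]_l -> R) M (x y : 'rV[R]_l) :
  continuous phi -> (forall u, `|phi u| <= M) -> dot x x = dot y y ->
  \int[mu]_(u in O) phi (x *m u^T) = \int[mu]_(u in O) phi (y *m u^T).
Proof.
move=> cphi bphi xy.
have cx (z : 'rV[R]_l) : continuous (fun u : 'M[R]_l => phi (z *m u)).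
  move=> u; apply: continuous_comp; last exact: cphi.
  exact: continuous_mull.
rewrite (@integral_transpose (fun u => phi (x *m u)) M)//.
rewrite (@integral_transpose (fun u => phi (y *m u)) M)//.
have [w Ow ->] := orthogonal_transitive xy.
rewrite -(@integral_translate _ _ _ haar (fun u => phi (x *m u)) M w)//.
by apply: eq_Rintegral => u _; rewrite mulmxA.
Qed.

End haar_orthogonal.

(** * Averages of a family of functions of one variable *)

Section parametric_family.
Context d (Omega : measurableType d) {R : realType}.
Variables (P : {measure set Omega -> \bar R}) (D : set Omega).
Hypotheses (mD : measurable D) (PD : (P D < +oo)%E).
Variables (phi phi' : Omega -> R -> R) (C M A : R).
Hypothesis dphi : forall w, D w -> forall r : R, is_derive r (1 : R) (phi w) (phi' w r).
Hypothesis lipphi : forall w, D w -> forall r s, `|phi' w r - phi' w s| <= C * `|r - s|.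
Hypothesis mphi : forall r, measurable_fun D (fun w => phi w r).
Hypothesis bphi : forall w, D w -> forall r, `|phi w r| <= M.
Hypothesis sphi : forall w, D w -> forall r, A < `|r| -> phi w r = 0.

Let C0 w : D w -> 0 <= C.
Proof. by move=> Dw; have := lipphi Dw 1 0; rewrite subr0 normr1 mulr1; exact: le_trans. Qed.

(** A point outside of the support, common to all [w], where [phi' w] vanishes;
    the Lipschitz condition then bounds [phi' w] everywhere. *)
Let dphi0 w : D w -> phi' w (`|A| + 1) = 0.
Proof.
move=> Dw; have dA := dphi Dw (`|A| + 1).
rewrite -(@derive_val _ _ _ _ _ _ _ dA).
rewrite (@near_eq_derive _ _ _ _ (cst 0)) ?derive_cst//.
near=> y.
apply: sphi => //; apply: (le_lt_trans (ler_norm A)).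
apply: lt_le_trans (ler_norm _); near: y.
by apply: (cvgr_gt (`|A| + 1)) => //; rewrite ltrDl.
Unshelve. all: end_near. Qed.

Let bphi' w r : D w -> `|phi' w r| <= C * (`|r| + `|A| + 1).
Proof.
move=> Dw; have := lipphi Dw r (`|A| + 1); rewrite dphi0// subr0 => /le_trans; apply.
rewrite ler_wpM2l ?(C0 Dw)// (le_trans (ler_normB _ _))//.
by rewrite [X in _ + X]ger0_norm ?addr_ge0// addrA.
Qed.

(** [phi' w r] is the limit of difference quotients with step 1/(n+1). *)
Let mphi' r : measurable_fun D (fun w => phi' w r).
Proof.
pose u n : R := n.+1%:R^-1.
apply: (@measurable_fun_cvg _ _ _ _
    (fun n w => (u n)^-1 * (phi w (u n *: 1 + r) - phi w r))).
  by move=> n; apply: measurable_funM => //; apply: measurable_funB.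
move=> w Dw; have dw := dphi Dw r.
have : h^-1 *: (phi w (h *: 1 + r) - phi w r) @[h --> (0 : R)^'] --> phi' w r.
  by rewrite -(@derive_val _ _ _ _ _ _ _ dw); exact: (@ex_derive _ _ _ _ _ _ _ dw).
move=> /cvgr_dnbhsP/(_ u); apply; split; last exact: cvg_harmonic.
by move=> n; rewrite invr_neq0.
Qed.

Let iphi r : P.-integrable D (EFin \o (fun w => phi w r)).
Proof. by apply: (@integrable_bounded _ _ _ _ _ _ M) => // w Dw; exact: bphi. Qed.

Let iphi' r : P.-integrable D (EFin \o (fun w => phi' w r)).
Proof.
apply: (@integrable_bounded _ _ _ _ _ _ (C * (`|r| + `|A| + 1))) => // w Dw; exact: (bphi' r Dw).
Qed.

Lemma is_derive_Rintegral (r : R) :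
  is_derive r (1 : R) (fun r => \int[P]_(w in D) phi w r) (\int[P]_(w in D) phi' w r).
Proof.
pose f (s : R) w := phi w s.
pose B := `|C| * (`|r| + 1 + `|A| + 1).
have B0 : 0 <= B by rewrite mulr_ge0// !addr_ge0.
have rin : `]r - 1, r + 1[%classic r by rewrite /= in_itv/= ltrBlDr ltrDl ltr01.
have pE s w : D w -> partial1of2 f s w = phi' w s.
  move=> Dw; have ? := dphi Dw s.
  by rewrite /partial1of2 derive1E derive_val.
have fi : forall x : R, `]r - 1, r + 1[%classic x -> P.-integrable D (EFin \o f x).
  by move=> x _; exact: iphi.
have df : forall (x : R) (y : Omega), `]r - 1, r + 1[%classic x -> D y -> derivable (f^~ y) x 1.
  by move=> x w _ Dw; have ? := dphi Dw x; exact: ex_derive.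
have Gi : P.-integrable D (EFin \o (fun _ : Omega => B)).
  by apply: (@integrable_bounded _ _ _ _ _ _ B) => // w _; rewrite ger0_norm.
have Gle : forall (x : R) (y : Omega), `]r - 1, r + 1[%classic x -> D y -> `|partial1of2 f x y| <= B.
  move=> x w; rewrite /= in_itv/= => /andP[rx xr] Dw; rewrite pE//.
  apply: (le_trans (bphi' x Dw)).
  apply: ler_pM; rewrite ?(C0 Dw) ?addr_ge0 ?ler_norm//.
  rewrite !lerD2r.
  have : `|x - r| <= 1 by rewrite ler_norml; apply/andP; split; lra.
  have := ler_normD (x - r) r; rewrite subrK => /le_trans h1 h2; apply: h1.
  by rewrite addrC lerD2l.
have d1 := @derivable_under_integral _ _ _ P f D mD r _ _ rin fi df (fun=> B) (fun=> B0) Gi Gle.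
have := @differentiation_under_integral _ _ _ P f D mD r _ _ rin fi df (fun=> B) (fun=> B0) Gi Gle.
rewrite (_ : \int[P]_(w in D) partial1of2 f r w = \int[P]_(w in D) phi' w r); last first.
  by apply: eq_Rintegral => w; rewrite inE => Dw; rewrite pE.
rewrite derive1E => <-.
exact/derivableP.
Qed.

Lemma lipschitz_Rintegral (r s : R) :
  `|\int[P]_(w in D) phi' w r - \int[P]_(w in D) phi' w s| <= C * fine (P D) * `|r - s|.
Proof.
rewrite -RintegralB//; [|exact: iphi'..].
have ib : P.-integrable D (EFin \o (fun w => phi' w r - phi' w s)).
  by rewrite /comp; under eq_fun do rewrite EFinB; apply: integrableB => //; exact: iphi'.
apply: (le_trans (le_normr_Rintegral mD ib)).
apply: (@le_trans _ _ (\int[P]_(w in D) (C * `|r - s|))).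
  apply: le_Rintegral => //.
  - exact: integrable_norm.
  - by apply: (@integrable_bounded _ _ _ _ _ _ `|C * `|r - s| |).
  - by move=> w Dw; exact: lipphi.
by rewrite Rintegral_cst// mulrAC.
Qed.

End parametric_family.

(** * Charts and the Riemannian distance *)

Section manifold_axioms.
Context {R : realType}.

Lemma manifold_second_countable (M : manifold R) : @second_countable M.
Proof. by case: M. Qed.

Lemma manifold_hausdorff (M : manifold R) : hausdorff_space M.
Proof. by case: M. Qed.

Lemma atlas_chart (M : manifold R) a : @atlas R M a -> is_chart a.
Proof. by case: M a => ? ? ? ? ? H ? ?; exact: H. Qed.

Lemma atlas_compatible (M : manifold R) a b :
  @atlas R M a -> atlas b -> compatible a b.
Proof. by case: M a b => ? ? ? ? ? ? H ?; exact: H. Qed.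

Lemma gram_smooth (M : manifold R) (g : riemannianMetric M) a i j :
  atlas a -> smooth_scalar (cimage a) (fun y => g a y i j).
Proof. by case: g => gr H ? ? aa; exact: H. Qed.

Lemma gram_change (M : manifold R) (g : riemannianMetric M) :
  metric_preserving (@atlas R M) (@atlas R M) g g setT id.
Proof. by case: g. Qed.

Lemma lmulVg (G : lieGroup R) (h : G) : lmul (linv h) h = lone G.
Proof. by case: G h => ? ? ? ? ? ? H ? ? h; exact: H. Qed.

Lemma linv_continuous (G : lieGroup R) : continuous (@linv R G).
Proof. by case: G => ? ? ? ? ? ? ? ? H x; exact: H.1. Qed.

Variables (G : lieGroup R) (K : set G) (X : homogeneousSpace K).

Lemma act1 (x : X) : act (lone G) x = x.
Proof. by case: X x. Qed.

Lemma actM h k (x : X) : act (lmul h k) x = act h (act k x).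
Proof. by case: X x => ? ? ? ? H ? ? ? x; exact: H. Qed.

Lemma act_smooth : smooth_map (prod_atlas (@atlas R G) (@atlas R X))
  (@atlas R X) setT (fun p => act p.1 p.2).
Proof. by case: X. Qed.

Lemma act_origin k : K k -> act k (origin X) = origin X.
Proof. by move: k; case: X => ? ? ? ? ? ? ? /= <-. Qed.

Lemma act_continuous : continuous (fun p : G * X => act p.1 p.2).
Proof. by have [H _] := act_smooth; move=> p; exact: H. Qed.

Lemma actK h (x : X) : act (linv h) (act h x) = x.
Proof. by rewrite -actM lmulVg act1. Qed.

Section flat_isometry.
Variables (g : riemannianMetric X) (l : nat) (E : set X).
Variable e : flatIsometry g l (origin X) E.

Lemma toEK : cancel (toE e) (ofE e). Proof. by case: e. Qed.
Lemma range_toE : range (toE e) = E. Proof. by case: e. Qed.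
Lemma toE0 : toE e 0 = origin X. Proof. by case: e. Qed.
Lemma toE_smooth :
  smooth_map (@euclidean_atlas R l) (@atlas R X) setT (toE e).
Proof. by case: e. Qed.
Lemma toE_isometry x y : rdist g (toE e x) (toE e y) = enorm (x - y).
Proof. by case: e => ? ? ? ? ? ? ? H; exact: H. Qed.
Lemma toE_continuous : continuous (toE e).
Proof. by have [H _] := toE_smooth; move=> p; exact: H. Qed.
Lemma ofEK z : E z -> toE e (ofE e z) = z.
Proof.
have rE := range_toE; move=> Ez.
have : range (toE e) z by rewrite rE.
by move=> [x _ <-]; rewrite toEK.
Qed.

End flat_isometry.

End manifold_axioms.

Lemma open_near (T : topologicalType) (A : set T) :
  (forall x, A x -> \forall y \near x, A y) -> open A.
Proof. by rewrite openE => H x /H. Qed.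

Section chart_facts.
Context {R : realType} {M : manifold R}.
Implicit Types a b : chart R (dimM M) M.

Lemma cmapK a x : atlas a -> cdom a x -> cinv a (cmap a x) = x.
Proof. by move=> /atlas_chart[_ _ H _ _]; exact: H. Qed.

Lemma cimage_cdom a y : atlas a -> cimage a y -> cdom a (cinv a y).
Proof. by move=> aa [x ax <-]; rewrite cmapK. Qed.

Lemma cinvK a y : atlas a -> cimage a y -> cmap a (cinv a y) = y.
Proof. by move=> aa [x ax <-]; rewrite cmapK. Qed.

Lemma cimage_open a : atlas a -> open (cimage a).
Proof. by move=> /atlas_chart[]. Qed.

Lemma cdom_open a : atlas a -> open (cdom a).
Proof. by move=> /atlas_chart[]. Qed.

Lemma cinv_continuous a y : atlas a -> cimage a y -> {for y, continuous (cinv a)}.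
Proof. by move=> /atlas_chart[_ _ _ _ H]; exact: H. Qed.

Lemma cmap_continuous a x : atlas a -> cdom a x -> {for x, continuous (cmap a)}.
Proof. by move=> /atlas_chart[_ _ _ H _]; exact: H. Qed.

Lemma cmap_cimage a x : cdom a x -> cimage a (cmap a x).
Proof. by move=> ax; exists x. Qed.

Lemma near_cinv a (U : set M) y : atlas a -> open U -> cimage a y ->
  U (cinv a y) -> \forall z \near y, cimage a z /\ U (cinv a z).
Proof.
move=> aa oU ay Uy; near=> z; split; near: z.
  by apply: open_nbhs_nbhs; split=> //; exact: cimage_open.
by apply: (cinv_continuous aa ay); exact: open_nbhs_nbhs.
Unshelve. all: by end_near. Qed.

Lemma transition_domain a b : atlas a ->
  cmap a @` (cdom a `&` cdom b) = [set y | cimage a y /\ cdom b (cinv a y)].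
Proof.
move=> aa; apply/seteqP; split=> [_ [x [ax bx] <-]|y [ay by_]].
  by split; [exact: cmap_cimage|rewrite cmapK].
exists (cinv a y); last exact: cinvK.
by split=> //; exact: cimage_cdom.
Qed.

Lemma transition_domain_open a b : atlas a -> atlas b ->
  open (cmap a @` (cdom a `&` cdom b)).
Proof.
move=> aa ab; rewrite transition_domain//; apply: open_near => y [ay by_].
by apply: near_cinv => //; exact: cdom_open.
Qed.

End chart_facts.

Lemma is_derive_row (R : realType) n (f : R -> 'rV[R]_n) (t : R) (d : 'rV[R]_n) :
  (forall j, is_derive t (1 : R) (fun s => f s 0 j) (d 0 j)) ->
  is_derive t (1 : R) f d.
Proof.
move=> H; have df : derivable f t 1.
  by apply/derivable_mxP => i j; rewrite ord1; exact: (@ex_derive _ _ _ _ _ _ _ (H j)).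
split=> //; rewrite (derive_mx df); apply/rowP => j.
by rewrite mxE (@derive_val _ _ _ _ _ _ _ (H j)).
Qed.

Section rdist_locally_bounded.
Context {R : realType} {M : manifold R} (g : riemannianMetric M).

Lemma arc_length_ge0 (c : R -> M) : 0 <= arc_length g c.
Proof. by apply: Rintegral_ge0 => t _; exact: sqrtr_ge0. Qed.

Lemma joined_ge0 x y L : joined g x y L -> 0 <= L.
Proof. by elim=> // c y' L' _ _ L0; rewrite addr_ge0// arc_length_ge0. Qed.

Lemma rdist_le x y L : joined g x y L -> rdist g x y <= L.
Proof.
move=> xyL; apply: ge_inf => //.
by exists 0 => L' /joined_ge0.
Qed.

(** A curve given in the coordinates of [a] has its regularity and its speed
    tested in the other charts [b]; this is the chain rule through the transition
    map. *)
Lemma derive_chart_curve (a b : chart R (dimM M) M) (gam dgam : R -> 'rV[R]_(dimM M)) (t : R) :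
  atlas a -> atlas b -> cimage a (gam t) -> cdom b (cinv a (gam t)) ->
  is_derive t (1 : R) gam (dgam t) ->
  is_derive t (1 : R) (cmap b \o (cinv a \o gam))
    (dgam t *m jacobian_mx (cmap b \o id \o cinv a) (gam t)).
Proof.
move=> aa ab agt bgt dg.
pose W := cmap a @` (cdom a `&` cdom b).
have oW : open W by exact: transition_domain_open.
have Wg : W (gam t) by rewrite /W transition_domain.
have Cab : compatible a b by exact: atlas_compatible.
have dgj k : is_derive t (1 : R) (fun s => gam s 0 k) (dgam t 0 k).
  have [d1 d2] := dg.
  have := (derivable_mxP gam t 1).1 d1 0 k => dk.
  split=> //; rewrite -d2 (derive_mx d1) mxE//.
have H j : is_derive t (1 : R) (fun s => (cmap b (cinv a (gam s))) 0 j)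
    (\sum_k 'D_(delta_mx 0 k) (fun y => (cmap b (cinv a y)) 0 j) (gam t) * dgam t 0 k).
  have df : differentiable (fun y => (cmap b (cinv a y)) 0 j) (gam t).
    by apply: (@class_C_differentiable _ _ 0 W) => //; exact: Cab.
  have := @derive_comp_coord _ _ _ (fun y => (cmap b (cinv a y)) 0 j) gam t 1 df
    (fun k => @ex_derive _ _ _ _ _ _ _ (dgj k)).
  under eq_bigr do rewrite (@derive_val _ _ _ _ _ _ _ (dgj _)).
  by [].
have dall : derivable (cmap b \o (cinv a \o gam)) t 1.
  by apply/derivable_mxP => i j; rewrite ord1; exact: (@ex_derive _ _ _ _ _ _ _ (H j)).
split=> //; rewrite (derive_mx dall); apply/rowP => j.
rewrite mxE (@derive_val _ _ _ _ _ _ _ (H j)) mxE; apply: eq_bigr => k _.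
by rewrite mxE mulrC.
Qed.

Section coordinate_curve.
Variables (a : chart R (dimM M) M) (aa : atlas a).
Variables (gam dgam : R -> 'rV[R]_(dimM M)).
Hypothesis gam_image : forall t, cimage a (gam t).
Hypothesis dgamP : forall t, is_derive t (1 : R) gam (dgam t).
Hypothesis dgam_cont : continuous dgam.

Let gam_cont : continuous gam.
Proof.
move=> t; have := dgamP t => d.
by apply: differentiable_continuous; apply/derivable1_diffP; exact: ex_derive.
Qed.

Lemma coordinate_curve_C1 : C1_curve (cinv a \o gam).
Proof.
have cc : continuous (cinv a \o gam).
  move=> t; apply: continuous_comp; first exact: gam_cont.
  by apply: cinv_continuous.
split=> // b t ab bct.
have D s : cdom b (cinv a (gam s)) -> is_derive s (1 : R) (cmap b \o (cinv a \o gam))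
    (dgam s *m jacobian_mx (cmap b \o id \o cinv a) (gam s)).
  by move=> bs; exact: derive_chart_curve.
have dt := D t bct; split; first exact: ex_derive.
apply: (@near_eq_continuous _ _ (fun s => dgam s *m jacobian_mx (cmap b \o id \o cinv a) (gam s))).
  have : \forall s \near t, cdom b ((cinv a \o gam) s).
    by apply: (cc t); apply: open_nbhs_nbhs; split=> //; exact: cdom_open.
  apply: filterS => s /D ds.
  by rewrite derive1E derive_val.
apply: continuous_mulmx; first exact: dgam_cont.
apply: (@cvg_coord _ _ _ _ _ (nbhs_filter t)) => i j.
rewrite mxE; under eq_fun do rewrite mxE.
apply: (@continuous_comp _ _ _ gam (fun y => 'D_(delta_mx 0 i) (fun y0 => (cmap b \o id \o cinv a) y0 0 j) y)).
  exact: gam_cont.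
have Cab := atlas_compatible aa ab j 1.
have [_ /(_ i)[_ C0]] := Cab.
by have [C00 _] := C0; apply: C00; rewrite transition_domain.
Qed.

Lemma coordinate_curve_speed t :
  speed g (cinv a \o gam) t = Num.sqrt (dot (dgam t *m g a (gam t)) (dgam t)).
Proof.
rewrite /speed; set x := (cinv a \o gam) t.
rewrite /chart_at; case: cid => b /= [ab bx].
have d := derive_chart_curve aa ab (gam_image t) bx (dgamP t).
rewrite derive1E (@derive_val _ _ _ _ _ _ _ d).
have ax : cdom a x by exact: cimage_cdom.
have := @gram_change _ _ g a b aa ab x I ax bx.
rewrite /= /x /= cinvK// => ->.
rewrite /dot trmx_mul !mulmxA; congr (Num.sqrt (_ 0 0)).
Qed.

Lemma coordinate_curve_length S :
  (forall t, dot (dgam t *m g a (gam t)) (dgam t) <= S ^+ 2) -> 0 <= S ->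
  arc_length g (cinv a \o gam) <= S.
Proof.
move=> bS S0.
have bs t : speed g (cinv a \o gam) t <= S.
  by rewrite coordinate_curve_speed -[leRHS]ger0_norm// -sqrtr_sqr ler_wsqrtr.
have nbs t : `|speed g (cinv a \o gam) t| <= S.
  by rewrite ger0_norm ?bs// sqrtr_ge0.
have cs : continuous (speed g (cinv a \o gam)).
  have -> : speed g (cinv a \o gam) =
      (fun t => Num.sqrt (dot (dgam t *m g a (gam t)) (dgam t))).
    by apply/funext => t; exact: coordinate_curve_speed.
  move=> t.
  apply: (@continuous_comp _ _ _ (fun t => dot (dgam t *m g a (gam t)) (dgam t)) Num.sqrt);
    last exact: sqrt_continuous.
  apply: (@continuous_comp _ _ _ (fun t => dgam t *m g a (gam t) *m (dgam t)^T)
    (fun A : 'M[R]_1 => A 0 0)); last exact: coord_continuous.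
  apply: continuous_mulmx.
    apply: continuous_mulmx; first exact: dgam_cont.
    apply: (@continuous_comp _ _ _ gam (g a)); first exact: gam_cont.
    apply: (@cvg_coord _ _ _ _ _ (nbhs_filter (gam t))) => i j.
    exact: (class_C_continuous (gram_smooth g i j aa 0%N) (gam_image t)).
  apply: (@continuous_comp _ _ _ dgam trmx); first exact: dgam_cont.
  exact: continuous_trmx.
have ms : measurable_fun [set: R] (speed g (cinv a \o gam)) by exact: continuous_measurable_fun.
have m01 : ((@lebesgue_measure R) `[0%R, 1%R]%classic < +oo)%E.
  by rewrite lebesgue_measure_itv/= lte_fin ltr01 -EFinB ltry.
apply: (@le_trans _ _ (\int[@lebesgue_measure R]_(x in `[0, 1]%classic) S)).
  apply: le_Rintegral => //.
  - apply: (@integrable_bounded _ _ _ _ _ _ S) => //; first exact: measurable_funTS.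
    by move=> t _; exact: nbs.
  - by apply: (@integrable_bounded _ _ _ _ _ _ S) => // t _; rewrite ger0_norm.
  - by move=> t _; exact: bs.
rewrite Rintegral_cst// [X in fine X](_ : _ = 1%E) ?mulr1//.
transitivity (@lebesgue_measure R `[0%R, 1%R]%classic) => //.
by rewrite lebesgue_measure_itv/= lte_fin ltr01 -EFinB subr0.
Qed.

End coordinate_curve.

Lemma quadratic_bound n (B : 'M[R]_n) (v : 'rV[R]_n) N r :
  0 <= N -> (forall i j, `|B i j| <= N) -> `|v| <= r ->
  dot (v *m B) v <= (n%:R * n%:R) * (N * r ^+ 2).
Proof.
move=> N0 BN vr.
have r0 : 0 <= r by exact: le_trans vr.
rewrite dotE.
apply: (@le_trans _ _ (\sum_(i < n) \sum_(j < n) N * r ^+ 2)).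
  apply: ler_sum => i _; rewrite mxE mulr_suml; apply: ler_sum => j _.
  apply: (le_trans (ler_norm _)); rewrite !normrM expr2.
  have vi k : `|v 0 k| <= r by apply: le_trans vr; exact: norm_coord_le.
  rewrite [X in X * _]mulrC -mulrA ler_pM// ?mulr_ge0//.
  by rewrite ler_pM.
rewrite !sumr_const !card_ord -[leLHS]mulr_natr -[X in X * _ <= _]mulr_natr.
by rewrite le_eqVlt; apply/orP; left; apply/eqP; ring.
Qed.

(** In the coordinates of a chart, two points of a small ball are joined by a
    segment, whose length is controlled by the entries of the Gram matrix. *)
Lemma rdist_locally_bounded (z : M) : exists (U : set M) (B : R),
  nbhs z U /\ forall x y, U x -> U y -> rdist g x y <= B.
Proof.
have [a [aa az]] := atlas_cover z.
pose y0 := cmap a z.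
have ay0 : cimage a y0 by exact: cmap_cimage.
pose N := 1 + \sum_i \sum_j `|g a y0 i j|.
have N0 : 0 <= N by rewrite addr_ge0// sumr_ge0// => i _; rewrite sumr_ge0.
have : \forall y \near y0, cimage a y /\ forall i j, `|g a y i j| <= N.
  near=> y; split; near: y.
    by apply: open_nbhs_nbhs; split=> //; exact: cimage_open.
  apply: filter_forall => i; apply: filter_forall => j.
  have cg : {for y0, continuous (fun y => g a y i j)}.
    exact: (class_C_continuous (gram_smooth g i j aa 0%N) ay0).
  have /cvgrPdist_le/(_ 1 ltr01) := cg.
  apply: filterS => y gy.
  apply: (@le_trans _ _ (1 + `|g a y0 i j|)).
    have := ler_normB (g a y0 i j) (g a y0 i j - g a y i j).
    rewrite opprB addrC subrK => /le_trans; apply.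
    by rewrite addrC lerD2r.
  rewrite lerD2l (bigD1 i)//= (bigD1 j)//= -addrA lerDl addr_ge0// ?sumr_ge0// => k _.
  by rewrite sumr_ge0.
move=> /nbhs_ballP[r /= r0 rN].
pose S2 := ((dimM M)%:R * (dimM M)%:R) * (N * (pi * (2 * r)) ^+ 2).
(* S2 bounds the square of the speed, and S2 <= (S2 + 1)^2 *)
exists [set x | cdom a x /\ ball y0 r (cmap a x)], (S2 + 1).
have S20 : 0 <= S2 by apply: mulr_ge0; [exact: mulr_ge0|apply: mulr_ge0 => //; exact: sqr_ge0].
have S0 : 0 <= S2 + 1 by exact: addr_ge0.
split.
  near=> x; split; near: x.
    by apply: open_nbhs_nbhs; split=> //; exact: cdom_open.
  by apply: (cmap_continuous aa az); exact: nbhsx_ballx.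
move=> x y [ax xr] [ay yr].
(* A C^1 curve is defined for all real parameters, so the segment is run through
   with a parameter which stays in [0, 1] and equals t at t = 0 and t = 1. *)
pose s (t : R) := (1 - cos (pi * t)) / 2.
pose ds (t : R) := pi * sin (pi * t) / 2.
have dsP (t : R) : is_derive t (1 : R) s (ds t).
  have d1 : is_derive t (1 : R) (fun t : R => pi * t) pi.
    by apply: is_derive_eq; rewrite ?scaler0 ?addr0; exact: mulr1.
  have d2 : is_derive t (1 : R) (cos \o (fun t : R => pi * t)) (- sin (pi * t) * pi).
    exact: is_derive1_comp.
  have -> : s = (2^-1 : R) \*: (cst 1 - cos \o (fun t : R => pi * t)).
    by apply/funext => q; rewrite /s/= mulrC.
  apply: is_derive_eq.
  by rewrite /ds /GRing.scale/=; ring.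
have cds : continuous ds.
  move=> t; apply: cvgM; last exact: cvg_cst.
  apply: cvgM; first exact: cvg_cst.
  apply: (@continuous_comp _ _ _ (fun t : R => pi * t) sin); last exact: continuous_sin.
  by apply: cvgM; [exact: cvg_cst|exact: cvg_id].
have s01 t : 0 <= s t <= 1.
  have := cos_geN1 (pi * t); have := cos_le1 (pi * t); rewrite /s => h1 h2.
  by apply/andP; split; lra.
have dsb t : `|ds t| <= pi.
  rewrite /ds !normrM [`|pi|]ger0_norm ?pi_ge0// -mulrA -[leRHS]mulr1.
  rewrite ler_wpM2l ?pi_ge0// normfV [X in _ / X]ger0_norm//.
  have : `|sin (pi * t)| <= 1 by rewrite ler_norml sin_geN1 sin_le1.
  by move=> ?; rewrite ler_pdivrMr//; lra.
pose u := cmap a x; pose w := cmap a y.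
pose gam t := u + s t *: (w - u).
pose dgam t := ds t *: (w - u).
have xr' : `|y0 - u| < r by move: xr; rewrite -ball_normE.
have yr' : `|y0 - w| < r by move: yr; rewrite -ball_normE.
have gb t : ball y0 r (gam t).
  rewrite -ball_normE /=.
  have -> : y0 - gam t = (1 - s t) *: (y0 - u) + s t *: (y0 - w).
    by apply/rowP => j; rewrite !mxE; ring.
  have /andP[] := s01 t; move: (s t) => q q0 q1.
  apply: (le_lt_trans (ler_normD _ _)).
  rewrite !normrZ (ger0_norm q0) [`|1 - q|]ger0_norm ?subr_ge0//.
  have [->|qn0] := eqVneq q 0; first by rewrite subr0 mul1r mul0r addr0.
  have qp : 0 < q by rewrite lt_neqAle eq_sym qn0.
  have -> : r = (1 - q) * r + q * r by ring.
  by rewrite ler_ltD// ?ler_wpM2l ?subr_ge0 ?(ltW xr')// ltr_pM2l.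
have dgamP t : is_derive t (1 : R) gam (dgam t).
  apply: is_derive_row => j.
  have -> : (fun q : R => gam q 0 j) = cst (u 0 j) + (w - u) 0 j \*: s.
    by apply/funext => q; rewrite /gam !mxE/= mulrC.
  have dst := dsP t.
  by apply: is_derive_eq; rewrite add0r /dgam [RHS]mxE /GRing.scale/= mulrC.
have dgc : continuous dgam.
  move=> t; apply: (@cvg_coord _ _ _ _ _ (nbhs_filter t)) => i j.
  rewrite mxE; under eq_fun do rewrite mxE.
  by apply: cvgM; [exact: cds|exact: cvg_cst].
have gim t : cimage a (gam t) by have [] := rN _ (gb t).
have len : arc_length g (cinv a \o gam) <= S2 + 1.
  apply: (coordinate_curve_length aa gim dgamP dgc) => // t.
  have [_ gN] := rN _ (gb t).
  apply: (@le_trans _ _ S2); last by rewrite expr2; nra.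
  apply: quadratic_bound => //.
  rewrite /dgam normrZ ler_pM//.
  have -> : w - u = (y0 - u) - (y0 - w) by rewrite opprB [RHS]addrC addrA subrK.
  by apply: (le_trans (ler_normB _ _)); lra.
have := joined_step (coordinate_curve_C1 aa gim dgamP dgc) (joined_refl g _).
rewrite addr0 /=.
have -> : gam 0 = u by rewrite /gam /s mulr0 cos0 subrr mul0r scale0r addr0.
have -> : gam 1 = w.
  by rewrite /gam /s mulr1 cospi opprK divff// scale1r addrC subrK.
rewrite !cmapK// => /rdist_le /le_trans; exact.
Unshelve. all: by end_near. Qed.

End rdist_locally_bounded.

(** * The test function on the flats through o *)

Section toE_proper.
Context {R : realType} {G : lieGroup R} {K : set G} {X : homogeneousSpace K}.
Context {g : riemannianMetric X} {l : nat} {E : set X}.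
Variable e : flatIsometry g l (origin X) E.

(** Near a point of [C] the distance is bounded, so all points of [E] there are
    within bounded distance of one of them, and [toE] preserves distances. The
    local bounds are made uniform by compactness. *)
Lemma toE_bounded (C : set X) : compact C ->
  exists B : R, forall x, C (toE e x) -> `|x| <= B.
Proof.
move=> /compact_near_coveringP cC.
have : \forall B \near +oo, C `<=` (fun z => forall x, toE e x = z -> `|x| <= B).
  apply: (cC _ _ (fun B z => forall x, toE e x = z -> `|x| <= B)) => z Cz.
  have [U [B [Uz UB]]] := rdist_locally_bounded g z.
  have [[x0 Ux0]|nU] := pselect (exists x0, U (toE e x0)); last first.
    exists (U, setT); first by split=> //; exact: filterT.
    by move=> [w B'] /= [Uw _] x xw; case: nU; exists x; rewrite xw.
  exists (U, [set B' | B + `|x0| <= B']).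
    by split=> //=; exact: nbhs_pinfty_ge (num_real _).
  move=> [w B'] /= [Uw BB'] x xw.
  apply: le_trans BB'; rewrite -lerBlDr.
  apply: (le_trans (lerB_dist _ _)); apply: (le_trans (norm_le_enorm _)).
  rewrite -(toE_isometry e); apply: UB => //.
  by rewrite xw.
move=> /filter_ex[B HB]; exists B => x Cx; exact: (HB _ Cx).
Qed.

Lemma orbit_bounded (C : set X) : compact K -> compact C ->
  exists B : R, forall k x, K k -> C (act k (toE e x)) -> `|x| <= B.
Proof.
move=> cK cC.
have cC' : compact ((fun p : G * X => act (linv p.1) p.2) @` (K `*` C)).
  apply: continuous_compact; last exact: compact_setX.
  apply: continuous_subspaceT => p.
  apply: (@continuous_comp _ _ _ (fun p : G * X => (linv p.1, p.2)) (fun p => act p.1 p.2));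
    last exact: act_continuous.
  apply: cvg_pair; last exact: cvg_snd.
  apply: (@continuous_comp _ _ _ fst (@linv R G)); first exact: cvg_fst.
  exact: linv_continuous.
have [B HB] := toE_bounded cC'.
exists B => k x Kk Ckx; apply: HB; exists (k, act k (toE e x)) => //=.
exact: actK.
Qed.

End toE_proper.

Section lines.
Context {R : realType} {n : nat}.
Implicit Types (P : 'rV[R]_n -> R) (W : set 'rV[R]_n).

Lemma class_C1_line P W (w y : 'rV[R]_n) (r : R) : open W -> class_C 1 W P ->
  W (r *: w + y) -> is_derive r (1 : R) (fun s : R => P (s *: w + y))
    (\sum_i w 0 i * 'D_(delta_mx 0 i) P (r *: w + y)).
Proof.
move=> oW CP Wr.
have dj j : is_derive r (1 : R) (fun s : R => (s *: w + y) 0 j) (w 0 j).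
  rewrite (_ : (fun s : R => (s *: w + y) 0 j) = (w 0 j \*: id) + cst (y 0 j)).
    by apply: is_derive_eq; rewrite addr0; exact: mulr1.
  by apply/funext => s; rewrite !mxE /= mulrC.
have := @derive_comp_coord _ _ _ P (fun s : R => s *: w + y) r 1
  (class_C_differentiable oW CP Wr) (fun j => @ex_derive _ _ _ _ _ _ _ (dj j)).
under eq_bigr do rewrite (@derive_val _ _ _ _ _ _ _ (dj _)) mulrC.
by [].
Qed.

Lemma continuous_line (w y : 'rV[R]_n) : continuous (fun s : R => s *: w + y).
Proof.
move=> r; apply: cvgD; last exact: cvg_cst.
by apply: cvgZr_tmp; exact: cvg_id.
Qed.

Lemma class_C2_line P W (w y : 'rV[R]_n) (r : R) : open W -> class_C 2 W P ->
  W (r *: w + y) ->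
  is_derive r (1 : R) (fun s : R => 'D_1 (fun s : R => P (s *: w + y)) s)
    (\sum_i w 0 i * \sum_j w 0 j *
      'D_(delta_mx 0 j) (fun z => 'D_(delta_mx 0 i) P z) (r *: w + y)).
Proof.
move=> oW CP Wr.
have nW : \forall s \near r, W (s *: w + y).
  exact: (@continuous_line w y r W (open_nbhs_nbhs (conj oW Wr))).
apply: (@near_eq_is_derive _ _ _
    (\sum_i (w 0 i \*: fun s : R => 'D_(delta_mx 0 i) P (s *: w + y)))).
  apply: filterS nW => s Ws; rewrite fct_sumE.
  by rewrite (@derive_val _ _ _ _ _ _ _ (class_C1_line oW (class_CS CP) Ws)).
apply: is_derive_sum => i; apply: is_deriveZ.
by apply: (class_C1_line oW) => //; have [_ /(_ i)[]] := CP.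
Qed.

(** Along a line the second derivative is the Hessian applied twice to the
    direction. *)
Lemma class_C2_line_bound P W (y0 : 'rV[R]_n) : open W -> class_C 2 W P -> W y0 ->
  exists B : R, \forall y \near y0, forall (w z : 'rV[R]_n) (r : R),
    `|w| <= 1 -> y = r *: w + z ->
    [/\ derivable (fun s : R => P (s *: w + z)) r 1,
        derivable (fun s : R => 'D_1 (fun s : R => P (s *: w + z)) s) r 1 &
      `|'D_1 (fun s : R => 'D_1 (fun s : R => P (s *: w + z)) s) r| <= B].
Proof.
move=> oW CP Wy0.
pose DD i j y := 'D_(delta_mx 0 j) (fun z => 'D_(delta_mx 0 i) P z) y.
have cDD i j : {for y0, continuous (DD i j)}.
  by have [_ /(_ i)[_ [_ /(_ j)[_ [Cij _]]]]] := CP; exact: Cij.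
exists (\sum_i \sum_j (`|DD i j y0| + 1)).
have nB : \forall y \near y0, W y /\ forall i j, `|DD i j y| <= `|DD i j y0| + 1.
  near=> y; split; near: y; first exact: open_nbhs_nbhs.
  apply: filter_forall => i; apply: filter_forall => j.
  have /cvgrPdist_le/(_ 1 ltr01) := cDD i j.
  apply: filterS => y gy.
  have := ler_normB (DD i j y0) (DD i j y0 - DD i j y).
  rewrite opprB addrC subrK => /le_trans; apply.
  by rewrite lerD2l.
apply: filterS nB => y [Wy By] w z r w1 ywz; rewrite ywz in Wy By.
have d1 := class_C1_line oW (class_CS CP) Wy.
have d2 := class_C2_line oW CP Wy.
split; [exact: (@ex_derive _ _ _ _ _ _ _ d1)|exact: (@ex_derive _ _ _ _ _ _ _ d2)|].
rewrite (@derive_val _ _ _ _ _ _ _ d2).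
have wi i : `|w 0 i| <= 1 by exact: le_trans (norm_coord_le _ _ _) w1.
apply: (le_trans (ler_norm_sum _ _ _)); apply: ler_sum => i _.
rewrite normrM -[leRHS]mul1r ler_pM//.
apply: (le_trans (ler_norm_sum _ _ _)); apply: ler_sum => j _.
by rewrite normrM -[leRHS]mul1r ler_pM// By.
Unshelve. all: by end_near. Qed.

End lines.

Section coordinates.
Context {R : realType}.

Context {G : lieGroup R} {K : set G} {X : homogeneousSpace K}.
Context {g : riemannianMetric X} {l : nat} {E : set X}.
Variable e : flatIsometry g l (origin X) E.
Variable f : X -> R.
Hypothesis f_smooth : smooth_fun f.
Local Notation n := (dimM G).
Local Notation m := (dimM X).

(** In charts the function (k, x) |-> f(k . toE x) is the composite of [theta],
    which expresses [toE] in coordinates, of [Xi], the action, and of [f]. *)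
Lemma class_C_local k (k0 : G) (x0 : 'rV[R]_l) :
  exists (a : chart R n G) (W : set 'rV[R]_(n + l)),
    [/\ atlas a, cdom a k0, open W, W (row_mx (cmap a k0) x0) &
        class_C k W (fun y => f (act (cinv a (lsubmx y)) (toE e (rsubmx y))))].
Proof.
have [a [aa ak0]] := atlas_cover k0.
have [b [ab bx0]] := atlas_cover (toE e x0).
have [c [ac cx0]] := atlas_cover (act k0 (toE e x0)).
pose W := [set y : 'rV[R]_(n + l) | [/\ cimage a (lsubmx y), cdom b (toE e (rsubmx y)) &
  cdom c (act (cinv a (lsubmx y)) (toE e (rsubmx y)))]].
pose V := [set w : 'rV[R]_(n + m) | [/\ cimage a (lsubmx w), cimage b (rsubmx w) &
  cdom c (act (cinv a (lsubmx w)) (cinv b (rsubmx w)))]].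
have oW : open W.
  apply: open_near => y [ay b_y cy].
  have ca : {for y, continuous (fun y : 'rV[R]_(n + l) => cinv a (lsubmx y))}.
    apply: continuous_comp; first exact: continuous_lsubmx.
    exact: cinv_continuous.
  have cb : {for y, continuous (fun y : 'rV[R]_(n + l) => toE e (rsubmx y))}.
    apply: continuous_comp; first exact: continuous_rsubmx.
    exact: toE_continuous.
  have cc : {for y, continuous (fun y : 'rV[R]_(n + l) => act (cinv a (lsubmx y)) (toE e (rsubmx y)))}.
    apply: (@continuous_comp _ _ _ (fun y : 'rV[R]_(n + l) => (cinv a (lsubmx y), toE e (rsubmx y))) (fun p => act p.1 p.2)).
      exact: (cvg_pair ca cb).
    exact: act_continuous.
  near=> z; split; near: z.
  - apply: (@continuous_lsubmx R 1 n l y); apply: open_nbhs_nbhs; split=> //.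
    exact: cimage_open.
  - by apply: cb; apply: open_nbhs_nbhs; split=> //; exact: cdom_open.
  - by apply: cc; apply: open_nbhs_nbhs; split=> //; exact: cdom_open.
have VE : V = (cmap (prod_chart a b) @` (cdom (prod_chart a b) `&` setT `&`
    (fun p => act p.1 p.2) @^-1` cdom c)).
  apply/seteqP; split=> [w [aw bw cw]|_ [[h z] [[/= [ah bz] _] cz] <-]].
    exists (cinv a (lsubmx w), cinv b (rsubmx w)).
      by split=> //; split=> //; split; exact: cimage_cdom.
    by rewrite /= !cinvK// hsubmxK.
  rewrite /V /= row_mxKl row_mxKr; split; [exact: cmap_cimage|exact: cmap_cimage|].
  by rewrite !cmapK.
have oV : open V.
  apply: open_near => w [aw bw cw].
  have ca : {for w, continuous (fun y : 'rV[R]_(n + m) => cinv a (lsubmx y))}.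
    apply: continuous_comp; first exact: continuous_lsubmx.
    exact: cinv_continuous.
  have cb : {for w, continuous (fun y : 'rV[R]_(n + m) => cinv b (rsubmx y))}.
    apply: continuous_comp; first exact: continuous_rsubmx.
    exact: cinv_continuous.
  have cc : {for w, continuous (fun y : 'rV[R]_(n + m) => act (cinv a (lsubmx y)) (cinv b (rsubmx y)))}.
    apply: (@continuous_comp _ _ _ (fun y : 'rV[R]_(n + m) => (cinv a (lsubmx y), cinv b (rsubmx y))) (fun p => act p.1 p.2)).
      exact: (cvg_pair ca cb).
    exact: act_continuous.
  near=> z; split; near: z.
  - apply: (@continuous_lsubmx R 1 n m w); apply: open_nbhs_nbhs; split=> //.
    exact: cimage_open.
  - apply: (@continuous_rsubmx R 1 n m w); apply: open_nbhs_nbhs; split=> //.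
    exact: cimage_open.
  - by apply: cc; apply: open_nbhs_nbhs; split=> //; exact: cdom_open.
exists a, W; split=> //.
  by rewrite /W/= row_mxKl row_mxKr cmapK//; split=> //; exact: cmap_cimage.
pose theta (y : 'rV[R]_(n + l)) : 'rV[R]_(n + m) := row_mx (lsubmx y) (cmap b (toE e (rsubmx y))).
pose Xi (w : 'rV[R]_(n + m)) : 'rV[R]_m := cmap c (act (cinv a (lsubmx w)) (cinv b (rsubmx w))).
have thetaV y : W y -> V (theta y).
  move=> [ay b_y cy]; rewrite /V/= row_mxKl row_mxKr cmapK//; split=> //.
  exact: cmap_cimage.
have CXi j : class_C k V (fun w => Xi w 0 j).
  have [_ H] := @act_smooth _ _ _ X.
  have pab : prod_atlas (@atlas R G) (@atlas R X) (prod_chart a b) by exists a, b.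
  have := H _ _ pab ac j k.
  by rewrite -VE.
have CtoE j : class_C k [set x : 'rV[R]_l | cdom b (toE e x)] (fun x => cmap b (toE e x) 0 j).
  have [_ H] := toE_smooth e.
  have eu : @euclidean_atlas R l (Chart setT id id) by [].
  have := H _ _ eu ab j k.
  apply: class_C_sub => x bx; exists x => //=.
have oB : open [set x : 'rV[R]_l | cdom b (toE e x)].
  have := @toE_continuous _ _ _ X _ _ _ e => /continuousP; apply; exact: cdom_open.
have Ctheta j : class_C k W (fun y => theta y 0 j).
  have [i|i] := split_ordP j => ->.
    apply: (@class_C_ext _ _ _ _ (fun y => y 0 (lshift l i))) => //.
      by move=> y _; rewrite row_mxEl mxE.
    exact: class_C_coord.
  apply: (@class_C_ext _ _ _ _ ((fun x => cmap b (toE e x) 0 i) \o rsubmx)) => //.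
    by move=> y _; rewrite /= row_mxEr.
  apply: (@class_C_comp _ _ _ _ _ [set x : 'rV[R]_l | cdom b (toE e x)]) => //.
    by move=> y [].
  move=> j'; apply: (@class_C_ext _ _ _ _ (fun y => y 0 (rshift n j'))) => //.
    by move=> y _; rewrite mxE.
  exact: class_C_coord.
apply: (@class_C_ext _ _ _ _ ((f \o cinv c) \o (Xi \o theta))) => //.
  move=> y [ay b_y cy].
  by rewrite /= /Xi /theta row_mxKl row_mxKr (cmapK ab b_y) (cmapK ac cy).
apply: (@class_C_comp _ _ _ _ _ (cimage c)) => //.
- exact: cimage_open.
- move=> y Wy; have [_ _ cy] := thetaV _ Wy; exact: cmap_cimage.
- move=> j; apply: (class_C_comp oW oV thetaV Ctheta (CXi j)).
- exact: f_smooth.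
Unshelve. all: by end_near. Qed.

(** The function [f] along a line through o of the flat k.E. *)
Let psi k v (r : R) := f (act k (toE e (r *: v))).

(** In the coordinates of [class_C_local], varying [r] is moving on a line in the
    direction [row_mx 0 v]. *)
Lemma second_derivative_local (k0 : G) (x0 : 'rV[R]_l) : exists B : R,
  \forall p \near (k0, x0), forall v r, `|v| <= 1 -> p.2 = r *: v ->
    [/\ derivable (psi p.1 v) r 1, derivable (fun s : R => 'D_1 (psi p.1 v) s) r 1 &
      `|'D_1 (fun s : R => 'D_1 (psi p.1 v) s) r| <= B].
Proof.
have [a [W [aa ak0 oW Wy0 CP]]] := class_C_local 2 k0 x0.
have [B HB] := class_C2_line_bound oW CP Wy0.
exists B.
have crow : {for (k0, x0), continuous (fun p : G * 'rV[R]_l => row_mx (cmap a p.1) p.2)}.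
  apply: (@cvg_coord _ _ _ _ _ (nbhs_filter (k0, x0))) => i j.
  have [q|q] := split_ordP j => ->.
    rewrite row_mxEl; under eq_fun do rewrite row_mxEl.
    apply: (@continuous_comp _ _ _ (fun p : G * 'rV[R]_l => cmap a p.1)
      (fun A : 'rV[R]_n => A i q)); last exact: coord_continuous.
    apply: (@continuous_comp _ _ _ fst (cmap a)); first exact: cvg_fst.
    exact: cmap_continuous.
  rewrite row_mxEr; under eq_fun do rewrite row_mxEr.
  apply: (@continuous_comp _ _ _ snd (fun A : 'rV[R]_l => A i q)).
    exact: cvg_snd.
  exact: coord_continuous.
have near1 : \forall p \near (k0, x0), cdom a p.1.
  apply: (@cvg_fst _ _ (nbhs k0) (nbhs x0)).
  by apply: open_nbhs_nbhs; split=> //; exact: cdom_open.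
apply: filterS2 near1 (crow _ HB) => -[k x] /= ak Bp v r v1 xrv.
pose w : 'rV[R]_(n + l) := row_mx 0 v.
pose y : 'rV[R]_(n + l) := row_mx (cmap a k) 0.
have Ly s : s *: w + y = row_mx (cmap a k) (s *: v).
  by rewrite /w /y scale_row_mx scaler0 add_row_mx add0r addr0.
have psiE : (fun s : R => f (act (cinv a (lsubmx (s *: w + y))) (toE e (rsubmx (s *: w + y))))) = psi k v.
  by apply/funext => s; rewrite Ly row_mxKl row_mxKr cmapK.
have w1 : `|w| <= 1.
  apply: norm_le_coord => // i j; rewrite ord1.
  have [q|q] := split_ordP j => ->; first by rewrite row_mxEl mxE normr0.
  by rewrite row_mxEr (le_trans (norm_coord_le _ _ _)).
have := Bp w y r w1; rewrite Ly -xrv => /(_ erefl).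
by rewrite psiE.
Unshelve. all: by end_near. Qed.

Lemma smooth_fun_continuous : continuous f.
Proof.
move=> z; have [a [aa az]] := atlas_cover z.
apply: (@near_eq_continuous _ _ ((f \o cinv a) \o cmap a)).
  near=> w; rewrite /= cmapK//; near: w.
  by apply: open_nbhs_nbhs; split=> //; exact: cdom_open.
apply: continuous_comp; first exact: cmap_continuous.
by apply: (class_C_continuous (f_smooth aa 0%N)); exact: cmap_cimage.
Unshelve. all: by end_near. Qed.

Variable C : set X.
Hypothesis (cC : compact C) (fC : forall z, ~ C z -> f z = 0).

Lemma compact_support_bounded : exists M : R, forall z, `|f z| <= M.
Proof.
have : compact (f @` C).
  by apply: continuous_compact => //; apply: continuous_subspaceT; exact: smooth_fun_continuous.
move=> /compact_bounded[M [_ HM]]; exists (`|M| + 1) => z.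
have [Cz|nCz] := pselect (C z); last by rewrite fC// normr0 addr_ge0.
apply: HM; last by exists z.
by rewrite (le_lt_trans (ler_norm _))// ltrDl.
Qed.

Hypothesis cK : compact K.

(** Where [r *: v] is large all functions vanish by [orbit_bounded]; the rest is
    covered by the compact set [K `*` D], on which the local bounds on the second
    derivative are uniform, and the derivative is then Lipschitz by the mean value
    inequality. *)
Lemma radial_regularity : exists A B : R, forall k v, K k -> enorm v = 1 ->
  [/\ forall r : R, derivable (psi k v) r 1,
      forall r s : R, `|'D_1 (psi k v) r - 'D_1 (psi k v) s| <= B * `|r - s| &
      forall r, A < `|r| -> psi k v r = 0].
Proof.
have [A0 HA0] := @orbit_bounded _ _ _ _ _ _ _ e C cK cC.
pose D := [set x : 'rV[R]_l | `|x| <= A0 + 1].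
have cD : compact D.
  apply: bounded_closed_compact.
    exists (A0 + 1); split; first exact: num_real.
    by move=> q Aq x /le_trans; apply; exact: ltW.
  apply: (@closed_comp _ _ (fun x : 'rV[R]_l => `|x|) [set r | r <= A0 + 1]).
    by move=> x _; exact: norm_continuous.
  exact: closed_le.
pose Q (B : R) (p : G * 'rV[R]_l) := forall v r, `|v| <= 1 -> p.2 = r *: v ->
    [/\ derivable (psi p.1 v) r 1, derivable (fun s : R => 'D_1 (psi p.1 v) s) r 1 &
      `|'D_1 (fun s : R => 'D_1 (psi p.1 v) s) r| <= B].
have : \forall B \near +oo, (K `*` D) `<=` Q B.
  have /compact_near_coveringP cKD := compact_setX cK cD.
  apply: (cKD _ _ Q) => -[k0 x0] _.
  have [B HB] := second_derivative_local k0 x0.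
  exists ([set p | Q B p], [set B' | B <= B']).
    by split=> //=; exact: nbhs_pinfty_ge (num_real _).
  move=> [p B'] /= [Qp BB'] v r v1 pv.
  by have [d1 d2 d3] := Qp v r v1 pv; split=> //; exact: (le_trans d3).
move=> /filter_ex[B HB].
(* A0 bounds the sup norm of [r *: v], and |r| is its Euclidean norm *)
exists (l%:R * `|A0| + 1), `|B| => k v Kk ev.
have v1 : `|v| <= 1 by rewrite -ev norm_le_enorm.
have psi0 r : A0 < `|r *: v| -> psi k v r = 0.
  move=> Ar; apply: fC => Cr.
  by have := HA0 k (r *: v) Kk Cr; rewrite leNgt Ar.
have H (r : R) : [/\ derivable (psi k v) r 1, derivable (fun s : R => 'D_1 (psi k v) s) r 1 &
      `|'D_1 (fun s : R => 'D_1 (psi k v) s) r| <= `|B|].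
  have [rA|rA] := leP `|r *: v| (A0 + 1).
    have [d1 d2 d3] := HB (k, r *: v) (conj Kk rA) v r v1 erefl.
    by split=> //; rewrite (le_trans d3)// ler_norm.
  have n0 : \forall s \near r, psi k v s = 0.
    have cn : {for r, continuous (fun s : R => `|s *: v|)}.
      apply: cvg_norm; apply: cvgZr_tmp; exact: cvg_id.
    have A0r : A0 < `|r *: v| by apply: lt_trans rA; rewrite ltrDl.
    have /cvgrPdist_lt/(_ (`|r *: v| - A0)) := cn; rewrite subr_gt0 => /(_ A0r).
    apply: filterS => s hs; apply: psi0.
    by have := le_lt_trans (ler_norm _) hs; rewrite ltrD2l ltrN2.
  have n1 : \forall s \near r, 'D_1 (psi k v) s = 0.
    move/near_join : n0; apply: filterS => s ns.
    by rewrite (@near_eq_derive _ _ _ _ (cst 0)) ?derive_cst.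
  split.
  - apply: (@near_eq_derivable _ _ _ (cst 0)); last exact: derivable_cst.
    by apply: filterS n0 => ? ->.
  - apply: (@near_eq_derivable _ _ _ (cst 0)); last exact: derivable_cst.
    by apply: filterS n1 => ? ->.
  - by rewrite (@near_eq_derive _ _ _ _ (cst 0)) ?derive_cst ?normr0.
split=> [r|r s|r rA].
- by have [] := H r.
- pose phi t := 'D_1 (psi k v) (t *: (1 : R) + s).
  have tE (t : R) : t *: (1 : R) = t by exact: mulr1.
  have -> : 'D_1 (psi k v) r - 'D_1 (psi k v) s = phi (r - s) - phi 0.
    by rewrite /phi !tE subrK add0r.
  apply: mean_value_bound => t _.
  have [_ d2 d3] := H (t *: (1 : R) + s).
  split; first exact: (derivable_line d2).
  by rewrite (derive_line (fun s : R => 'D_1 (psi k v) s)).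
- apply: psi0; rewrite ltNge; apply/negP => rvA.
  move: rA; rewrite ltNge => /negP; apply.
  have -> : `|r| = enorm (r *: v) by rewrite enormZ ev mulr1.
  apply: (le_trans (enorm_le_norm _)).
  rewrite -[leLHS]addr0 lerD// ler_wpM2l//.
  by rewrite (le_trans rvA)// ler_norm.
Qed.

End coordinates.

(** * Inversion for real functions *)

Section xray_inversion.
Context {R : realType} {G : lieGroup R} {K : set G} {X : homogeneousSpace K}.
Context {g : riemannianMetric X} {l : nat} {E : set X}.
Variable e : flatIsometry g l (origin X) E.
Local Notation O := (@orthogonal_group R l : set (borel 'M[R]_l)).
Local Notation mu := (@lebesgue_measure R).

Lemma rdist_ofE x y : E x -> E y -> rdist g x y = enorm (ofE e x - ofE e y).
Proof. by move=> Ex Ey; rewrite -(toE_isometry e) !ofEK. Qed.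

Lemma rdist_origin x : E x -> rdist g (origin X) x = enorm (ofE e x).
Proof.
move=> Ex; have := toE_isometry e 0 (ofE e x).
by rewrite toE0 ofEK// sub0r enormN.
Qed.

(** Geodesics of [E] are curves that locally preserve distances, and [E] is
    Euclidean. *)
Lemma tangent_geodesic_line (p : R) (c : R -> X) : tangent_geodesic e p c ->
  exists q v t0, [/\ enorm v = 1, enorm q = p, dot q v = 0 &
    forall t, ofE e (c t) = q + (t - t0) *: v].
Proof.
move=> [gc cE [t0 [dp dc tan]]].
have cEt t : E (c t) by apply: cE; exists t.
have [t|v v1 Hv] := @isometric_curve_affine R l (fun t => ofE e (c t)).
  have [d d0 Hd] := gc t I; exists d => // s s' st s't.
  by rewrite -(toE_isometry e) !ofEK// Hd.
exists (ofE e (c t0)), v, t0; split=> //.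
- by rewrite -dp rdist_origin.
- have Dv : is_derive t0 (1 : R) (ofE e \o c) v.
    apply: is_derive_row => j.
    have -> : (fun s : R => (ofE e \o c) s 0 j) = cst (ofE e (c 0) 0 j) + v 0 j \*: id.
      by apply/funext => s; rewrite /= Hv !mxE/= mulrC.
    by apply: is_derive_eq; rewrite add0r; exact: mulr1.
  by move: tan; rewrite derive1E (@derive_val _ _ _ _ _ _ _ Dv).
- by move=> t; rewrite (Hv t) (Hv t0) -addrA -scalerDl [t0 + _]addrC subrK.
Qed.

Lemma tangent_geodesic_rot (p : R) (c : R -> X) u : O u ->
  tangent_geodesic e p c -> tangent_geodesic e p (fun t => rotE e u (c t)).
Proof.
move=> Ou [gc cE [t0 [dp dc tan]]].
have cEt t : E (c t) by apply: cE; exists t.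
have Out := orthogonal_tr Ou.
have dE x y : E x -> E y -> rdist g (rotE e u x) (rotE e u y) = rdist g x y.
  move=> Ex Ey; rewrite /rotE toE_isometry -mulmxBl /enorm dot_orthogonal//.
  by rewrite rdist_ofE.
have oE : ofE e \o (fun t => rotE e u (c t)) = (fun t => (ofE e \o c) t *m u^T).
  by apply/funext => t; rewrite /rotE /= toEK.
have ofE0 : ofE e (origin X) = 0 by have := toEK e 0; rewrite toE0.
have o0 : rotE e u (origin X) = origin X.
  by rewrite /rotE ofE0 mul0mx toE0.
have Eo : E (origin X).
  by rewrite -[X in X _](range_toE e); exists 0; rewrite // toE0.
have Dc : is_derive t0 (1 : R) (fun t => (ofE e \o c) t *m u^T) ('D_1 (ofE e \o c) t0 *m u^T).
  have dcj j : is_derive t0 (1 : R) (fun t => (ofE e \o c) t 0 j) ('D_1 (ofE e \o c) t0 0 j).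
    split; first by exact: ((derivable_mxP (ofE e \o c) t0 1).1 dc 0 j).
    by rewrite (derive_mx dc) mxE.
  apply: is_derive_row => j.
  have -> : (fun s : R => ((ofE e \o c) s *m u^T) 0 j) =
      \sum_k (u^T k j \*: (fun s : R => (ofE e \o c) s 0 k)).
    by apply/funext => s; rewrite mxE fct_sumE; apply: eq_bigr => k _; rewrite /= mulrC.
  apply: is_derive_eq.
  by rewrite mxE; apply: eq_bigr => k _; rewrite mulrC.
split.
- move=> t _; have [d d0 Hd] := gc t I; exists d => // s s' _ _ st s't.
  by rewrite dE// Hd.
- by move=> _ [t _ <-]; rewrite -[X in X _](range_toE e); exact: imageT.
- exists t0; split.
  + by rewrite -{1}o0 dE.
  + by rewrite oE; exact: (@ex_derive _ _ _ _ _ _ _ Dc).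
  + rewrite oE derive1E (@derive_val _ _ _ _ _ _ _ Dc) /rotE toEK (dot_orthogonal _ _ Out).
    by rewrite -derive1E.
Qed.

Variable muK : probability (borel G) R.
Hypothesis muK1 : muK K = 1%E.
Variable muO : probability (borel 'M[R]_l) R.
Hypothesis haarO : haar_probability (@mulmx R l l l) (@orthogonal_group R l) muO.
Hypothesis cK : compact K.
Variable gamma : R -> R -> X.
Hypothesis gammaP : forall p, 0 < p -> tangent_geodesic e p (gamma p).
Variable f : X -> R.
Hypothesis f_smooth : smooth_fun f.
Variable C : set X.
Hypothesis (cC : compact C) (fC : forall z, ~ C z -> f z = 0).

Let Kb : set (borel G) := K.
Let D : set (borel G * borel 'M[R]_l) := Kb `*` O.
Let P : probability (borel G * borel 'M[R]_l)%type R := (muK \x muO)%E.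

Let mK : measurable Kb.
Proof.
rewrite -(setCK Kb); apply: measurableC; apply: sub_sigma_algebra.
by apply/closed_openC; apply: compact_closed => //; exact: manifold_hausdorff.
Qed.

Let mO : measurable O. Proof. exact: measurable_orthogonal. Qed.

Let mD : measurable D. Proof. exact: measurableX. Qed.

Let PD1 : P D = 1%E.
Proof.
apply: (etrans (product_measure1E muK muO mK mO)); rewrite -[RHS]mule1.
by congr (_ * _)%E; [exact: muK1|exact: haarO.1].
Qed.

Let PDlty : (P D < +oo)%E. Proof. by rewrite PD1 ltry. Qed.

Let continuous_orbit : continuous (fun z : G * 'rV[R]_l => f (act z.1 (toE e z.2))).
Proof.
move=> z.
apply: (@continuous_comp _ _ _ (fun z : G * 'rV[R]_l => (z.1, toE e z.2)) (fun w => f (act w.1 w.2))).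
  apply: cvg_pair; first exact: cvg_fst.
  by apply: (@continuous_comp _ _ _ snd (toE e)); [exact: cvg_snd|exact: toE_continuous].
apply: (@continuous_comp _ _ _ (fun w : G * X => act w.1 w.2) f).
  exact: act_continuous.
exact: smooth_fun_continuous.
Qed.

Let measurable_orbit d (W : measurableType d) (i : W -> G) (j : W -> 'rV[R]_l) :
  borel_fun i -> borel_fun j ->
  measurable_fun setT (fun w => f (act (i w) (toE e (j w)))).
Proof.
move=> bi bj; apply: borel_fun_measurable.
have bij := borel_fun_pair (@manifold_second_countable _ G) (@second_countable_matrix R 1 l) bi bj.
exact: (borel_fun_comp continuous_orbit bij).
Qed.

Let bounded_f : exists M : R, forall z, `|f z| <= M.
Proof. exact: (compact_support_bounded f_smooth cC fC). Qed.

Let continuous_k k : continuous (fun x => f (act k (toE e x))).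
Proof.
move=> x; apply: (@continuous_comp _ _ _ (fun x => (k, x)) (fun z : G * 'rV[R]_l => f (act z.1 (toE e z.2)))).
  have ca : {for x, continuous (fun=> k)} by exact: cst_continuous.
  have cb : {for x, continuous (@id 'rV[R]_l)} by exact: cvg_id.
  exact: (cvg_pair ca cb).
exact: continuous_orbit.
Qed.

Let average_radial (x y : 'rV[R]_l) : dot x x = dot y y ->
  \int[muK]_(k in Kb) \int[muO]_(u in O) f (act k (toE e (x *m u^T))) =
  \int[muK]_(k in Kb) \int[muO]_(u in O) f (act k (toE e (y *m u^T))).
Proof.
move=> xy; have [M HM] := bounded_f.
apply: eq_Rintegral => k _.
exact: (@integral_orthogonal_radial _ _ _ haarO (fun x => f (act k (toE e x))) M).
Qed.

Let borel_trmul (x : 'rV[R]_l) :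
  borel_fun (fun w : borel G * borel 'M[R]_l => x *m (w.2 : 'M[R]_l)^T).
Proof.
have c : continuous (fun u : 'M[R]_l => x *m u^T).
  by move=> u; apply: continuous_mulmx; [exact: cst_continuous|exact: continuous_trmx].
apply: (borel_fun_comp c).
by apply/borel_fun_idE; exact: measurable_snd.
Qed.

Let borel_k : borel_fun (fun w : borel G * borel 'M[R]_l => (w.1 : G)).
Proof. by apply/borel_fun_idE; exact: measurable_fst. Qed.

Let iterated (x : 'rV[R]_l) :
  \int[P]_(w in D) f (act w.1 (toE e (x *m w.2^T))) =
  \int[muK]_(k in Kb) \int[muO]_(u in O) f (act k (toE e (x *m u^T))).
Proof.
have [M HM] := bounded_f.
apply: (@Rintegral_prod1 _ _ _ _ R muK muO Kb O
  (fun w => f (act w.1 (toE e (x *m w.2^T)))) mK mO).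
  apply: (@integrable_bounded _ _ _ _ _ _ M) => //.
  by apply: measurable_funTS; exact: (measurable_orbit borel_k (borel_trmul x)).
move=> k Kk; apply: (@integrable_bounded _ _ _ muO _ _ M) => //.
  exact: probability_lty.
apply: measurable_funTS; apply: borel_fun_measurable.
have c : continuous (fun u : 'M[R]_l => f (act k (toE e (x *m u^T)))).
  move=> u; apply: (@continuous_comp _ _ _ (fun u : 'M[R]_l => x *m u^T) (fun x => f (act k (toE e x)))).
    by apply: continuous_mulmx; [exact: cst_continuous|exact: continuous_trmx].
  exact: continuous_k.
exact: (borel_fun_comp c (@borel_fun_id 'M[R]_l)).
Qed.

Lemma exists_unit_vector : exists v1 : 'rV[R]_l, enorm v1 = 1.
Proof.
by have [q [v [t0 [v1 _ _ _]]]] := tangent_geodesic_line (gammaP ltr01); exists v.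
Qed.

Section radial_average.
Variables (v1 : 'rV[R]_l) (v1_unit : enorm v1 = 1).

Let phi (w : G * 'M[R]_l) (r : R) := f (act w.1 (toE e (r *: (v1 *m w.2^T)))).
(** The average of the test function over the sphere of radius [r], as an even
    function on the line. *)
Let H (r : R) := \int[P]_(w in D) phi w r.
Let h (r : R) := \int[P]_(w in D) 'D_1 (phi w) r.

Let HE (r : R) :
  H r = \int[muK]_(k in Kb) \int[muO]_(u in O) f (act k (toE e ((r *: v1) *m u^T))).
Proof.
by rewrite -iterated /H; apply: eq_Rintegral => w _; rewrite /phi scalemxAl.
Qed.

Let H_even r : H (- r) = H r.
Proof.
rewrite !HE; apply: average_radial.
by rewrite !(dotZl, dotZr) !mulrA mulrNN.
Qed.

Let H0 : H 0 = f (origin X).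
Proof.
transitivity (\int[P]_(w in D) f (origin X)).
  apply: eq_Rintegral => -[k u]; rewrite inE => -[/= Kk _].
  by rewrite /phi scale0r toE0 act_origin.
by rewrite Rintegral_cst// [X in fine X](_ : _ = 1%E) ?mulr1.
Qed.

(** The bounds of [radial_regularity] are uniform in [w], so they pass to the
    average. *)
Let H_regular : exists A L, [/\ 0 < A, forall r : R, is_derive r (1 : R) H (h r),
  forall r s, `|h r - h s| <= L * `|r - s| & forall r, A < `|r| -> H r = 0].
Proof.
have [A [B HAB]] := radial_regularity e f_smooth cC fC cK.
have [M HM] := bounded_f.
have unit w : D w -> enorm (v1 *m w.2^T) = 1.
  by move=> [_ Ow]; rewrite /enorm dot_orthogonal//; exact: orthogonal_tr.
have reg w (Dw : D w) := HAB w.1 (v1 *m w.2^T) Dw.1 (unit w Dw).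
have d1 : forall w, D w -> forall r : R, is_derive r (1 : R) (phi w) ('D_1 (phi w) r).
  by move=> w Dw r; apply/derivableP; have [+ _ _] := reg w Dw; exact.
have d2 : forall w, D w -> forall r s : R, `|'D_1 (phi w) r - 'D_1 (phi w) s| <= B * `|r - s|.
  by move=> w Dw r s; have [_ + _] := reg w Dw; exact.
have d3 : forall w, D w -> forall r : R, A < `|r| -> phi w r = 0.
  by move=> w Dw r; have [_ _] := reg w Dw; exact.
have d4 : forall r : R, measurable_fun D (fun w => phi w r).
  move=> r; apply: measurable_funTS.
  apply: (measurable_orbit borel_k).
  rewrite (_ : (fun w : borel G * borel 'M[R]_l => r *: (v1 *m (w.2 : 'M[R]_l)^T)) =
     (fun w : borel G * borel 'M[R]_l => (r *: v1) *m (w.2 : 'M[R]_l)^T)).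
    exact: borel_trmul.
  by apply/funext => w; rewrite scalemxAl.
have d5 : forall w, D w -> forall r, `|phi w r| <= M by move=> w _ r; exact: HM.
exists (`|A| + 1), (B * fine (P D)); split.
- by rewrite ltr_wpDl.
- by move=> r; exact: (is_derive_Rintegral mD PDlty d1 d2 d4 d5 d3).
- by move=> r s; exact: (lipschitz_Rintegral mD PDlty d1 d2 d4 d3).
- move=> r Ar; transitivity (\int[P]_(w in D) (cst 0 w : R)).
    apply: eq_Rintegral => w; rewrite inE => Dw; apply: d3 => //.
    by apply: lt_trans Ar; rewrite (le_lt_trans (ler_norm A))// ltrDl.
  by rewrite Rintegral_cst// mul0r.
Qed.

Let F (p : R) := \int[muK]_(k in Kb) \int[muO]_(u in O)
  \int[mu]_t f (act k (rotE e u (gamma p t))).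

(** Fubini's theorem brings the average over [D] inside the integral along the
    line, where it only sees the distance to the origin. *)
Let F_abel p : 0 < p -> F p = \int[mu]_t H (Num.sqrt (p ^+ 2 + t ^+ 2)).
Proof.
move=> p0.
have [q [v [t0 [v_unit qp qv gE]]]] := tangent_geodesic_line (gammaP p0).
have [M HM] := bounded_f.
have [A0 HA0] := orbit_bounded e cK cC.
pose x (t : R) : 'rV[R]_l := q + t *: v.
have xx t : dot (x t) (x t) = p ^+ 2 + t ^+ 2.
  rewrite /x !(dotDl, dotDr, dotZl, dotZr) (dotC v q) qv -!enorm_sqr qp v_unit.
  by ring.
pose Phi (z : (borel G * borel 'M[R]_l) * R) := f (act z.1.1 (toE e (x z.2 *m z.1.2^T))).
pose A := l%:R * `|A0| + 1.
have Phi0 w t : D w -> A < `|t| -> Phi (w, t) = 0.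
  move=> [Kw Ow] At; apply: fC => Cw.
  have := HA0 _ _ Kw Cw; rewrite leNgt => /negP; apply.
  have : A < enorm (x t *m w.2^T).
    rewrite /enorm dot_orthogonal; last exact: orthogonal_tr.
    apply: (lt_le_trans At); rewrite xx -sqrtr_sqr ler_wsqrtr// lerDr sqr_ge0//.
  move=> /lt_le_trans /(_ (enorm_le_norm _)) => lA.
  rewrite ltNge; apply/negP => xA.
  move: lA; rewrite ltNge => /negP; apply.
  rewrite -[leLHS]addr0 lerD// ler_wpM2l// (le_trans xA)//.
  exact: ler_norm.
have mPhi : measurable_fun setT Phi.
  have b1 : borel_fun (fun z : (borel G * borel 'M[R]_l) * R => (z.1.1 : G)).
    by apply/borel_fun_idE; apply: measurableT_comp measurable_fst.
  apply: (measurable_orbit b1).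
  have b2 : borel_fun (fun z : (borel G * borel 'M[R]_l) * R => (z.1.2 : 'M[R]_l)).
    by apply/borel_fun_idE; apply: measurableT_comp measurable_fst.
  have b3 : borel_fun (fun z : (borel G * borel 'M[R]_l) * R => (z.2 : R)).
    by apply: measurable_borel_fun; exact: measurable_snd.
  have b4 := borel_fun_pair (@second_countable_matrix R l l) (@second_countable_R R) b2 b3.
  have c : continuous (fun z : 'M[R]_l * R => x z.2 *m z.1^T).
    move=> z; apply: (@continuous_mulmx _ _ _ _ _ (fun z : 'M[R]_l * R => x z.2) (fun z => z.1^T)).
      apply: cvgD; first exact: cvg_cst.
      by apply: cvgZr_tmp; exact: cvg_snd.
    apply: (@continuous_comp _ _ _ fst trmx); first exact: cvg_fst.
    exact: continuous_trmx.
  exact: (borel_fun_comp c b4).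
have mDR : measurable (D `*` [set: R]) by exact: measurableX.
pose I : set R := `[- A, A]%classic.
have mI : measurable I by exact: measurable_itv.
have I_fin : (mu I < +oo)%E.
  by rewrite lebesgue_measure_itv/=; case: ifP => _; rewrite ?ltry// -EFinB ltry.
have nI t : ~ I t -> A < `|t|.
  by rewrite /I /= in_itv/= => /negP; rewrite -ler_norml -ltNge.
have iPhi : (P \x mu)%E.-integrable (D `*` [set: R]) (EFin \o Phi).
  have PhiM z : `|Phi z| <= M by exact: HM.
  have PhiI w t : D w -> ~ I t -> Phi (w, t) = 0 by move=> Dw /nI; exact: Phi0.
  exact: (@integrable_bounded_slab _ _ _ _ R P mu D I Phi M mD PDlty mI I_fin mPhi PhiM PhiI).
have iPhi1 w : D w -> mu.-integrable setT (fun t => (Phi (w, t))%:E).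
  move=> Dw; apply: (@integrable_bounded_support _ _ M A).
  - exact: (measurableT_comp mPhi).
  - by move=> t; exact: HM.
  - by move=> t; exact: Phi0.
have iPhi2 t : setT t -> P.-integrable D (fun w => (Phi (w, t))%:E).
  move=> _; apply: (@integrable_bounded _ _ _ _ _ _ M) => //; last first.
    by move=> w _; exact: HM.
  by apply: measurable_funTS; exact: (measurableT_comp mPhi).
have E1 := Rintegral_prod1 mD measurableT iPhi iPhi1.
have E2 := Rintegral_prod2 mD measurableT iPhi iPhi2.
have iG := integrable_Rintegral_prod mD measurableT iPhi iPhi1.
transitivity (\int[P]_(w in D) \int[mu]_t Phi (w, t)).
  have iGk k : Kb k -> muO.-integrable O (fun u => (\int[mu]_t Phi ((k, u), t))%:E).
    move=> Kk.
    have mPhik : measurable_fun setT (fun z : borel 'M[R]_l * R => Phi ((k, z.1), z.2)).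
      apply: (measurableT_comp mPhi).
      apply: measurable_fun_pair => /=; last exact: measurable_snd.
      by apply: measurable_fun_pair => //; exact: measurable_fst.
    have PhikM (z : borel 'M[R]_l * R) : `|Phi ((k, z.1), z.2)| <= M by exact: HM.
    have PhikI u t : O u -> ~ I t -> Phi ((k, (u, t).1), (u, t).2) = 0.
      by move=> Ou /nI; exact: Phi0.
    apply: (@integrable_Rintegral_prod _ _ _ _ _ muO mu O setT (fun z => Phi ((k, z.1), z.2)) mO measurableT).
      exact: (@integrable_bounded_slab _ _ _ _ R muO mu O I _ M mO (probability_lty muO mO) mI I_fin mPhik PhikM PhikI).
    by move=> u Ou; exact: (iPhi1 (k, u) (conj Kk Ou)).
  rewrite (Rintegral_prod1 mK mO iG iGk).
  (* the parameter t0 of the point of contact disappears by translation *)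
  apply: eq_Rintegral => k; rewrite inE => Kk.
  apply: eq_Rintegral => u; rewrite inE => Ou.
  rewrite -[RHS]mul1r -invr1 -(Rintegral_affine (- t0) ltr01 (iPhi1 (k, u) (conj Kk Ou))).
  apply: eq_Rintegral => t _.
  by rewrite /Phi /rotE gE mul1r.
rewrite -E1 E2; apply: eq_Rintegral => t _.
apply: (etrans (iterated (x t))); apply: etrans (esym (HE _)).
apply: average_radial.
rewrite xx !(dotZl, dotZr) -enorm_sqr v1_unit expr1n mulr1 -expr2 sqr_sqrtr//.
by rewrite addr_ge0// sqr_ge0.
Qed.

Lemma xray_inversion_real (Fr : R -> R) : (forall p, 0 < p -> Fr p = F p) ->
  [/\ forall p : R, 0 < p -> derivable Fr p 1,
    mu.-integrable `]0, +oo[%classic (fun p => (derive1 Fr p / p)%:E) &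
    \int[mu]_(p in `]0, +oo[%classic) (derive1 Fr p / p) = - pi * f (origin X)].
Proof.
move=> FrE.
have [A [L [A0 dH lipH sH]]] := H_regular.
have [a1 a2 a3] := abel_inversion A0 dH lipH H_even sH.
pose F0 p := \int[mu]_t H (Num.sqrt (p ^+ 2 + t ^+ 2)).
have nF (p : R) : 0 < p -> \forall q \near p, F0 q = Fr q.
  move=> p0; near=> q.
  have q0 : 0 < q by near: q; exact: lt_nbhsr.
  by rewrite FrE// F_abel.
have dF (p : R) : 0 < p -> derive1 F0 p = derive1 Fr p.
  by move=> p0; rewrite !derive1E; apply: near_eq_derive; exact: nF.
split.
- by move=> p p0; apply: near_eq_derivable (a1 p p0); exact: nF.
- apply: eq_integrable a2 => // p; rewrite inE/= in_itv/= andbT => p0.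
  by rewrite -dF.
- rewrite -H0 -a3; apply: eq_Rintegral => p; rewrite inE/= in_itv/= andbT => p0.
  by rewrite -dF.
Unshelve. all: by end_near. Qed.

End radial_average.

End xray_inversion.

(** * Complex test functions *)

Lemma Re_div_real (R : rcfType) (z : R[i]) (p : R) :
  complex.Re (z / (p%:C)%C) = complex.Re z / p.
Proof.
by rewrite -[((p%:C)%C)^-1](fmorphV (real_complex R)); case: z => a b /=; rewrite mulr0 subr0.
Qed.

Lemma Im_div_real (R : rcfType) (z : R[i]) (p : R) :
  complex.Im (z / (p%:C)%C) = complex.Im z / p.
Proof.
by rewrite -[((p%:C)%C)^-1](fmorphV (real_complex R)); case: z => a b /=; rewrite mulr0 add0r.
Qed.

Section components.
Context {R : realType} {G : lieGroup R} {K : set G} {X : homogeneousSpace K}.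
Context {g : riemannianMetric X} {l : nat} {E : set X}.
Variable e : flatIsometry g l (origin X) E.
Variables (muK : probability (borel G) R) (muO : probability (borel 'M[R]_l) R).
Local Notation O := (@orthogonal_group R l : set (borel 'M[R]_l)).

(** The curves over which [omega] integrates all belong to Gamma_p, since
    the isometries of [E] fixing o preserve tangency. *)
Lemma omega_xray p (c : R -> X) (f : X -> R[i]) : tangent_geodesic e p c ->
  omega e muK muO p c (xray f) = Complex
    (\int[muK]_(k in (K : set (borel G))) \int[muO]_(u in O)
      \int[@lebesgue_measure R]_t complex.Re (f (act k (rotE e u (c t)))))
    (\int[muK]_(k in (K : set (borel G))) \int[muO]_(u in O)
      \int[@lebesgue_measure R]_t complex.Im (f (act k (rotE e u (c t))))).
Proof.
move=> tc.
have inGamma (k : G) (u : 'M[R]_l) : K k -> O u ->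
    `[< Gamma e p (fun t => act k (rotE e u (c t))) >].
  move=> Kk Ou; apply/asboolP; exists k, (fun t => rotE e u (c t)); split.
  - exact: Kk.
  - exact: (tangent_geodesic_rot Ou tc).
  - by [].
rewrite /omega /cintegral; congr Complex.
  apply: eq_Rintegral => k; rewrite inE => Kk.
  by apply: eq_Rintegral => u; rewrite inE => Ou; rewrite inGamma.
apply: eq_Rintegral => k; rewrite inE => Kk.
by apply: eq_Rintegral => u; rewrite inE => Ou; rewrite inGamma.
Qed.

End components.

Theorem theorem5p1 (R : realType) (G : lieGroup R)
    (G_connected : connected [set: G])
    (G_noncompact : ~ compact [set: G])
    (G_semisimple : semisimple G)
    (G_center : finite_set (lie_center G))
    (K : set G) (K_maxcompact : maximal_compact K)
    (X : homogeneousSpace K)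
    (g : riemannianMetric X) (g_invariant : invariant_metric g)
    (l : nat) (l_rank : is_rank g l) (l_gt1 : (1 < l)%N)
    (E : set X) (E_flat : flat_totally_geodesic g l E) (E_o : E (origin X))
    (e : flatIsometry g l (origin X) E)
    (muK : probability (borel (lg_manifold G)) R)
    (muK_haar : haar_probability (@lmul R G) K muK)
    (muO : probability (borel 'M[R]_l) R)
    (muO_haar : haar_probability (@mulmx R l l l) (@orthogonal_group R l) muO)
    (gamma : R -> R -> X)
    (gamma_tangent : forall p, 0 < p -> tangent_geodesic e p (gamma p))
    (f : X -> R[i]) (f_test : smooth_compact_support f) :
  let F p := omega e muK muO p (gamma p) (xray f) in
  [/\ forall p, 0 < p -> cderivable F p,
      cintegrable (@lebesgue_measure R) `]0, +oo[%classic
        (fun p => cderive F p / (p%:C)%C) &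
      f (origin X) = - ((pi : R)^-1%:C)%C *
        cintegral (@lebesgue_measure R) `]0, +oo[%classic
          (fun p => cderive F p / (p%:C)%C)].
Proof.
move=> F.
have [smooth_Re smooth_Im cf] := f_test.
have [_ cK _] := K_maxcompact.
have [v1 v1_unit] := exists_unit_vector gamma_tangent.
have f0 z : ~ closure [set x | f x != 0] z -> f z = 0.
  by move=> Cz; apply/eqP/negP => /negP fz; apply: Cz; exact: subset_closure.
have f0_Re z : ~ closure [set x | f x != 0] z -> complex.Re (f z) = 0.
  by move=> /f0 ->.
have f0_Im z : ~ closure [set x | f x != 0] z -> complex.Im (f z) = 0.
  by move=> /f0 ->.
have [dRe iRe intRe] := xray_inversion_real muK_haar.1 muO_haar cK
  gamma_tangent smooth_Re cf f0_Re v1_unit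
  (fun p p0 => congr1 (@complex.Re R) (omega_xray muK muO f (gamma_tangent p p0))).
have [dIm iIm intIm] := xray_inversion_real muK_haar.1 muO_haar cK
  gamma_tangent smooth_Im cf f0_Im v1_unit
  (fun p p0 => congr1 (@complex.Im R) (omega_xray muK muO f (gamma_tangent p p0))).
split.
- by move=> p p0; split; [exact: dRe|exact: dIm].
- split.
    by apply: eq_integrable iRe => // p _; rewrite Re_div_real.
  by apply: eq_integrable iIm => // p _; rewrite Im_div_real.
- set I := cintegral _ _ _.
  have -> : I = Complex (- pi * complex.Re (f (origin X))) (- pi * complex.Im (f (origin X))).
    congr Complex.
      by apply: etrans intRe; apply: eq_Rintegral => p _; exact: Re_div_real.
    by apply: etrans intIm; apply: eq_Rintegral => p _; exact: Im_div_real.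
  case: (f (origin X)) => a b.
  have pi0 : (pi : R) != 0 by rewrite gt_eqF// pi_gt0.
  apply/eqP; rewrite eq_complex /= !(oppr0, mul0r, subr0, addr0).
  by rewrite !mulrA mulrNN mulVf// !mul1r !eqxx.
Qed.
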